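(* Let $p\in(0,1)$, $p\neq 7/8$. Then $\Gamma_n\to\Gamma^{(p)}$ almost surely for some random vector $\Gamma^{(p)}$. For $p<7/8$, $\Gamma^{(p)}=\gamma_0:=(1/3,1/3)^\top$ almost surely. For $p>7/8$, $\Gamma^{(p)}$ takes the values $\gamma_p$ and $\bar\gamma_p$, where $$\gamma_p=\Big(\tfrac{8p^2-10p+3+\sqrt{32p^2-52p+21}}{2(2p-1)^2},\ \tfrac{8p^2-10p+3-\sqrt{32p^2-52p+21}}{2(2p-1)^2}\Big)^\top$$ and $\bar\gamma_p$ is obtained from $\gamma_p$ by replacing $\sqrt{32p^2-52p+21}$ with $-\sqrt{32p^2-52p+21}$. Moreover, for each $\gamma$ in the support of $\Gamma^{(p)}$, on the event $\{\Gamma^{(p)}=\gamma\}$, $$\mathbb E\big(e_{n+1}e_{n+1}^\top\mid\mathcal G_n\big)\xrightarrow{\text{a.s.}}\sigma(\gamma):=\begin{pmatrix}\gamma_1-\gamma_1^2&-\gamma_1\gamma_2\\-\gamma_1\gamma_2&\gamma_2-\gamma_2^2\end{pmatrix}.$$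
   Context: A random variable is $\mathrm{Rad}(q)$ if it equals $+1$ with probability $q$ and $-1$ with probability $1-q$. Random walk with two memory channels with parameter $p\in(0,1)$: $S_0=0$; $X_1,X_2$ are i.i.d. $\mathrm{Rad}(1/2)$; for each $n\ge 2$, let $U_{1,n+1},U_{2,n+1}$ be i.i.d. uniform on $\{1,\dots,n\}$ and $\alpha_{1,n+1},\alpha_{2,n+1}$ i.i.d. $\mathrm{Rad}(p)$, all mutually independent and independent of $X_1,\dots,X_n$ (and earlier draws); $T_{n+1}=\alpha_{1,n+1}X_{U_{1,n+1}}+\alpha_{2,n+1}X_{U_{2,n+1}}$, $X_{n+1}=\max(-1,\min(1,T_{n+1}))$, $S_n=X_1+\dots+X_n$. $S_n^{\pm}$ denotes the number of $\pm1$ steps among $X_1,\dots,X_n$, and $\Gamma_n=(S_n^+/n,\,S_n^-/n)^\top$. $\mathcal G_n=\sigma(\Gamma_1,\dots,\Gamma_n)$. Let $h_p(x)=\big(((1-p)x_1+px_2-1)^2-(1-x_1-x_2)^2-x_1,\ ((1-p)x_2+px_1-1)^2-(1-x_1-x_2)^2-x_2\big)^\top$ for $x\in[0,1]^2$, and for $n\ge2$, $e_{n+1}=(n+1)(\Gamma_{n+1}-\Gamma_n)-h_p(\Gamma_n)$. *)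

(* Defs.v *)
From HB Require Import structures.
From mathcomp Require Import all_boot all_order all_algebra.
From mathcomp Require Import all_classical all_reals all_analysis.
Set Implicit Arguments. Unset Strict Implicit. Unset Printing Implicit Defensive.
Import Order.TTheory GRing.Theory Num.Theory.
Import numFieldNormedType.Exports.
Local Open Scope classical_set_scope.
Local Open Scope ring_scope.

Definition clip (t : int) : int := Num.max (-1) (Num.min 1 t).

Section Walk.
Variables (x1 x2 : int) (u1 u2 a1 a2 : nat -> int).

(* walk n = [:: X_1; ...; X_n]  (X_j is the (j-1)-th entry).
   For k = n+1 >= 3:
   X_{n+1} = clip(a1 (n+1) * X_{u1 (n+1)} + a2 (n+1) * X_{u2 (n+1)}). *)
Fixpoint walk (n : nat) : seq int :=
  match n with
  | 0 => [::]
  | 1 => [:: x1]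
  | 2 => [:: x1; x2]
  | S m => let s := walk m in
           rcons s (clip (a1 (S m) * nth 0 s (absz (u1 (S m))).-1
                        + a2 (S m) * nth 0 s (absz (u2 (S m))).-1))
  end.
End Walk.

Section Model.
Variables (R : realType) (d : measure_display) (T : measurableType d).
Variables (x1 x2 : T -> int) (u1 u2 a1 a2 : nat -> T -> int).

Definition walk_at (n : nat) (w : T) : seq int :=
  walk (x1 w) (x2 w) (u1 ^~ w) (u2 ^~ w) (a1 ^~ w) (a2 ^~ w) n.

Definition Xstep (k : nat) (w : T) : int := nth 0 (walk_at k w) k.-1.

Definition Splus (n : nat) (w : T) : nat := count (fun x => x == 1) (walk_at n w).
Definition Sminus (n : nat) (w : T) : nat := count (fun x => x == -1) (walk_at n w).

Definition vec2 (a b : R) : 'cV[R]_2 :=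
  \col_(i < 2) (if (i : nat) == 0%N then a else b).

Definition Gamma (n : nat) (w : T) : 'cV[R]_2 :=
  vec2 ((Splus n w)%:R / n%:R) ((Sminus n w)%:R / n%:R).

End Model.

Definition h_p (R : realType) (p : R) (x : 'cV[R]_2) : 'cV[R]_2 :=
  let y1 := x 0 0 in let y2 := x 1 0 in
  vec2 (((1 - p) * y1 + p * y2 - 1) ^+ 2 - (1 - y1 - y2) ^+ 2 - y1)
       (((1 - p) * y2 + p * y1 - 1) ^+ 2 - (1 - y1 - y2) ^+ 2 - y2).

Definition e_vec (R : realType) (d : measure_display) (T : measurableType d)
  (p : R) (x1 x2 : T -> int) (u1 u2 a1 a2 : nat -> T -> int) (n : nat) (w : T)
  : 'cV[R]_2 :=
  let G := Gamma R x1 x2 u1 u2 a1 a2 in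
  n%:R *: (G n w - G n.-1 w) - h_p p (G n.-1 w).

(* Elementary conditional expectation given the sigma-algebra generated *)
(* by a discrete (finitely-valued) random variable [key]:               *)
(*   E(Y | sigma(key))(w) = E[Y ; key = key w] / P(key = key w).         *)
(* (a version of the conditional expectation; its values on atoms of   *)
(* probability zero are irrelevant)                                     *)
Definition cond_exp_discrete (R : realType) (d : measure_display)
  (T : measurableType d) (P : probability T R) (K : Type)
  (key : T -> K) (Y : T -> R) (w : T) : R :=
  let A := [set x | key x = key w] in
  fine (\int[P]_(x in A) (Y x)%:E) / fine (P A).

(* E( e_{n+1} e_{n+1}^T | G_n ),  G_n = sigma(Gamma_1, ..., Gamma_n),
   computed entrywise. *)
Definition cond_cov (R : realType) (d : measure_display) (T : measurableType d)
  (P : probability T R) (p : R) (x1 x2 : T -> int)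
  (u1 u2 a1 a2 : nat -> T -> int) (n : nat) (w : T) : 'M[R]_2 :=
  let key := fun x => [seq Gamma R x1 x2 u1 u2 a1 a2 k x | k <- iota 1 n] in
  let E := e_vec p x1 x2 u1 u2 a1 a2 n.+1 in
  \matrix_(i < 2, j < 2)
     cond_exp_discrete P key (fun x => (E x *m (E x)^T) i j) w.

Inductive bidx := bX1 | bX2 | bU1 of nat | bU2 of nat | bA1 of nat | bA2 of nat.

Definition base_var (T : Type) (x1 x2 : T -> int) (u1 u2 a1 a2 : nat -> T -> int)
  (i : bidx) : T -> int :=
  match i with
  | bX1 => x1 | bX2 => x2
  | bU1 k => u1 k | bU2 k => u2 k | bA1 k => a1 k | bA2 k => a2 k
  end.

(* the variables actually used: X_1, X_2 and, for k = n+1 with n >= 2,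
   U_{1,k}, U_{2,k}, alpha_{1,k}, alpha_{2,k} *)
Definition used_idx (i : bidx) : bool :=
  match i with
  | bX1 | bX2 => true
  | bU1 k | bU2 k | bA1 k | bA2 k => (2 < k)%N
  end.

Definition mutually_independent_discrete (R : realType) (d : measure_display)
  (T : measurableType d) (P : probability T R) (I : Type) (D : I -> bool)
  (Y : I -> T -> int) : Prop :=
  forall (m : nat) (f : 'I_m -> I), injective f -> (forall j, D (f j)) ->
  forall v : 'I_m -> int,
    P (\big[setI/setT]_(j < m) (Y (f j) @^-1` [set v j]))
    = (\prod_(j < m) P (Y (f j) @^-1` [set v j]))%E.

Definition is_Rad (R : realType) (d : measure_display) (T : measurableType d)
  (P : probability T R) (q : R) (Z : T -> int) : Prop :=
  P (Z @^-1` [set 1]) = q%:E /\ P (Z @^-1` [set -1]) = (1 - q)%:E.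

Definition is_unif (R : realType) (d : measure_display) (T : measurableType d)
  (P : probability T R) (n : nat) (Z : T -> int) : Prop :=
  forall j : int, (1 <= j <= n%:Z) -> P (Z @^-1` [set j]) = (n%:R^-1)%:E.

Definition two_channel_model (R : realType) (d : measure_display)
  (T : measurableType d) (P : probability T R) (p : R)
  (x1 x2 : T -> int) (u1 u2 a1 a2 : nat -> T -> int) : Prop :=
  let Y := base_var x1 x2 u1 u2 a1 a2 in
  [/\ (forall i v, used_idx i -> measurable (Y i @^-1` [set v])),
      mutually_independent_discrete P used_idx Y,
      is_Rad P (1/2) x1 /\ is_Rad P (1/2) x2,
      (forall n, (2 <= n)%N -> is_unif P n (u1 n.+1) /\ is_unif P n (u2 n.+1))
    & (forall n, (2 <= n)%N -> is_Rad P p (a1 n.+1) /\ is_Rad P p (a2 n.+1))].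

Definition gamma0 (R : realType) : 'cV[R]_2 := vec2 (1/3) (1/3).

Definition gamma_p (R : realType) (p : R) : 'cV[R]_2 :=
  let s := Num.sqrt (32 * p ^+ 2 - 52 * p + 21) in
  let a := 8 * p ^+ 2 - 10 * p + 3 in
  let c := 2 * (2 * p - 1) ^+ 2 in
  vec2 ((a + s) / c) ((a - s) / c).

Definition gammabar_p (R : realType) (p : R) : 'cV[R]_2 :=
  let s := - Num.sqrt (32 * p ^+ 2 - 52 * p + 21) in
  let a := 8 * p ^+ 2 - 10 * p + 3 in
  let c := 2 * (2 * p - 1) ^+ 2 in
  vec2 ((a + s) / c) ((a - s) / c).

Definition sigma_mx (R : realType) (g : 'cV[R]_2) : 'M[R]_2 :=
  let g1 := g 0 0 in let g2 := g 1 0 in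
  \matrix_(i < 2, j < 2)
    (if (i : nat) == 0%N then (if (j : nat) == 0%N then g1 - g1 ^+ 2 else - (g1 * g2))
     else (if (j : nat) == 0%N then - (g1 * g2) else g2 - g2 ^+ 2)).

(* Main.v *)
Require Import Defs.
From HB Require Import structures.
From mathcomp Require Import all_boot all_order all_algebra.
From mathcomp Require Import all_classical all_reals all_analysis.
From mathcomp Require Import measurable_realfun.
From mathcomp Require Import ring lra zify.
Import Order.TTheory GRing.Theory Num.Theory.
Import numFieldNormedType.Exports.
Local Open Scope classical_set_scope.
Local Open Scope ring_scope.
Set Implicit Arguments. Unset Strict Implicit. Unset Printing Implicit Defensive.

(* Write n for the time, N for the number of nonzero steps, s = S_n / n,
   t = N / n and q = 2p - 1. Given the past, the next step has mean q s (2 - t)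
   and is nonzero with probability 2t - 3t^2/2 + q^2 s^2/2, so (s, t) follows,
   with step size 1/n, the planar flow
     s' = s (q (2 - t) - 1),   t' = t - 3t^2/2 + q^2 s^2/2.
   No martingale theory is needed: if E L_{n+1} <= E L_n - E V_n / n + c_n with
   L bounded below and c_n summable, then sum E V_n / n < oo, hence
   sum V_n / n < oo almost surely, and since V changes by O(1/n) per step,
   V_n -> 0 almost surely.
   For q < 3/4 a quadratic form in (s, t - 2/3) is such a function L. For
   q > 3/4, put t_0 = 2 - 1/q and let r_0 be the nonzero equilibrium value of s^2:
   L = (q/4) (s^2 - r_0 ln s^2) + (t - t_0)^2/2 decreases along the flow like
   (t - t_0)^2, and -(t - t_0)(s^2 - r_0) then controls s^2 - r_0. In the discrete
   setting the logarithm is regularised to ln (s^2 + 128/n); the error this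
   produces is n / (S_n^2 + 128 n), which is itself a Lyapunov function because
   the noise pushes S_n away from 0, unless t is small; and t is kept away from
   0 by the function (W - 2)_+^2 / W of W = n / (N - 1). *)

(** * Summable sequences *)

Section BoundedSums.
Context {R : realType}.
Implicit Types (a b c u : nat -> R).

(** The critical value comes from t_0 = 2 - 1/q: it exceeds 2/3 exactly when q > 3/4, that is p >
    7/8, and r_0 = t_0 (3 t_0 - 2) / q^2 is positive with it. The point s = 0, t = 2/3 is then still
    an equilibrium, and excluding it as a limit is the real obstacle. The logarithm serves this
    purpose, but its regularisation costs a multiple of [spread] / n, and [spread] is a priori only
    bounded, so that this cost is not obviously summable. Expectations are computed by a finite
    recursion on lists of steps. A function of (n, S, N) after a step x in {1, -1, 0} is dominated
    by A + B x + C x^2, so a one-step bound needs only the means of x and of x^2. The Lyapunov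
    argument gives the limit of s^2; the sign of s settles because steps shrink, and the symmetry of
    the walk shows that both signs have positive probability. The covariance needs no estimate:
    e_{n+1} is a centred indicator vector, so its conditional covariance is sigma at the step
    probabilities. These are continuous in Gamma_n, and each limit point is fixed by them. *)

Definition bsum b := exists M, forall n, \sum_(k < n) b k <= M.

Lemma bsumD b c : bsum b -> bsum c -> bsum (fun n => b n + c n).
Proof.
move=> [M hM] [M' hM']; exists (M + M') => n.
by rewrite big_split /= lerD ?hM ?hM'.
Qed.

Lemma bsumZ x b : 0 <= x -> bsum b -> bsum (fun n => x * b n).
Proof.
move=> x0 [M hM]; exists (x * M) => n.
by rewrite -mulr_sumr ler_wpM2l ?hM.
Qed.

Lemma bsum_near_le0 b n0 : (forall n, (n0 <= n)%N -> b n <= 0) -> bsum b.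
Proof.
move=> hb; exists (\sum_(k < n0) `|b k|) => n.
have abs_le m : \sum_(k < m) b k <= \sum_(k < m) `|b k|.
  by apply: ler_sum => i _; exact: ler_norm.
case: (leqP n n0) => [nn0|n0n].
  apply: (le_trans (abs_le n)).
  rewrite -!(big_mkord xpredT (fun k => `|b k|)).
  by rewrite [leRHS](big_cat_nat (n := n)) //= lerDl sumr_ge0.
apply: (le_trans _ (abs_le n0)).
rewrite -!(big_mkord xpredT b) [leLHS](big_cat_nat (n := n0) _ (ltnW n0n)) //= gerDl.
rewrite big_nat_cond; apply: sumr_le0 => i; rewrite andbT => /andP[h _].
exact: hb.
Qed.

Lemma bsum_near_le b c n0 :
  (forall n, (n0 <= n)%N -> b n <= c n) -> bsum c -> bsum b.
Proof.
move=> hbc hc.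
have h : bsum (fun n => b n - c n).
  by apply: (@bsum_near_le0 _ n0) => n /hbc; rewrite subr_le0.
have [M hM] := bsumD h hc; exists M => n; apply: le_trans (hM n).
by apply: ler_sum => i _; rewrite subrK.
Qed.

Lemma bsum_inv_sqr : bsum (fun n => n.+2%:R ^- 2 : R).
Proof.
exists 1 => n; apply: (@le_trans _ _ (1 - n.+1%:R^-1)); last first.
  by rewrite gerBl invr_ge0 ler0n.
elim: n => [|n IHn]; first by rewrite big_ord0 invr1 subrr.
rewrite big_ord_recr /=.
apply: (le_trans (lerD IHn (lexx _))).
have n1 : 0 < n.+1%:R :> R by rewrite ltr0n.
have n2 : 0 < n.+2%:R :> R by rewrite ltr0n.
rewrite -addrA lerD2l -lerBrDl opprK addrC.
have -> : n.+1%:R^-1 - n.+2%:R^-1 = n.+1%:R^-1 * n.+2%:R^-1 :> R.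
  by rewrite -natr1 in n2 *; field; rewrite !gt_eqF.
rewrite expr2 invfM ler_wpM2r ?invr_ge0 ?ler0n// lef_pV2 ?posrE//.
by rewrite ler_nat.
Qed.

(** Deterministic form of the Lyapunov criterion: the decrements of [a] telescope, and its lower
    bound caps their sum. *)
Lemma bsum_telescope a b c n0 A :
  (forall n, (n0 <= n)%N -> a n.+1 <= a n - b n + c n) ->
  (forall n, A <= a n) -> bsum c -> bsum b.
Proof.
move=> hstep hA hc.
have h : bsum (fun n => a n - a n.+1).
  exists (a 0%N - A) => n; suff -> : \sum_(k < n) (a k - a k.+1) = a 0%N - a n.
    by rewrite lerB.
  elim: n => [|n IHn]; first by rewrite big_ord0 subrr.
  by rewrite big_ord_recr /= IHn; ring.
by apply: (bsum_near_le _ (bsumD h hc)) => n /hstep ?; lra.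
Qed.

Lemma bsum_cvg u : (forall n, 0 <= u n) -> bsum u -> cvgn (series u).
Proof.
move=> u0 [M hM]; apply: nondecreasing_is_cvgn.
  by apply: nondecreasing_series => n _ _; exact: u0.
by exists M => _ [n _ <-]; rewrite seriesEord; exact: hM.
Qed.

(* The squares [u n ^+ 2] have summable increments, hence converge; the limit
   vanishes because the harmonic series diverges. *)
Lemma slowly_varying_cvg0 u C :
  (forall n, 0 <= u n) ->
  (forall n, `|u n.+1 - u n| <= C / n.+2%:R) ->
  bsum (fun n => u n / n.+2%:R) -> u @ \oo --> (0 : R).
Proof.
move=> u0 uC us.
have C0 : 0 <= C.
  have := le_trans (normr_ge0 _) (uC 0%N).
  by rewrite pmulr_lge0// invr_gt0 ltr0n.
pose v n := u n ^+ 2.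
have vs : bsum (fun n => `|v n.+1 - v n|).
  pose w n := (2 * C) * (u n / n.+2%:R) + C ^+ 2 * n.+2%:R ^- 2.
  apply: (@bsum_near_le _ w 0%N); last first.
    apply: bsumD; apply: bsumZ => //; first by rewrite mulr_ge0.
      by rewrite sqr_ge0.
    exact: bsum_inv_sqr.
  move=> n _; rewrite /v subr_sqr normrM.
  set h := n.+2%:R^-1 : R; have h0 : 0 <= h by rewrite invr_ge0 ler0n.
  have := uC n; rewrite -/h => hu.
  have h2 : `|u n.+1 + u n| <= 2 * u n + C * h.
    rewrite ger0_norm ?addr_ge0//; have := ler_norm (u n.+1 - u n); lra.
  have -> : w n = (C * h) * (2 * u n + C * h) by rewrite /w -[_ ^- 2]exprVn -/h; ring.
  exact: ler_pM.
have vc : cvgn v.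
  have : cvgn (series (telescope v)).
    by apply: normed_cvg; apply: bsum_cvg => // n; exact: normr_ge0.
  rewrite telescopeK => /cvg_ex[l hl]; apply/cvg_ex; exists (l + v 0%N).
  have := cvgD hl (cvg_cst (v 0%N)); rewrite [X in X @ _](_ : _ = v); first exact.
  by apply/funext => n; exact: subrK.
have := cvg_comp _ _ vc (@sqrt_continuous R (limn v)).
set L := Num.sqrt _; rewrite (_ : _ \o _ = u); last first.
  by apply/funext => n /=; rewrite /v sqrtr_sqr ger0_norm.
move=> uL; suff L0 : L <= 0.
  by rewrite (_ : 0 = L)//; apply/eqP; rewrite eq_le L0 sqrtr_ge0.
rewrite leNgt; apply/negP => L0.
have [n0 _ hn0] : \forall n \near \oo, L / 2 < u n.
  by apply: (cvgr_gt L) => //; lra.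
have hs : bsum (fun n => n.+2%:R^-1 : R).
  suff : bsum (fun n => (L / 2) * n.+2%:R^-1).
    move=> /(@bsumZ (L / 2)^-1) h; have L2 : L / 2 != 0 by rewrite gt_eqF//; lra.
    have := h; rewrite invr_ge0 => /(_ (ltac:(lra))).
    by under eq_fun do rewrite mulKf//.
  apply: (@bsum_near_le _ _ n0 _ us) => n /hn0/ltW h.
  by rewrite ler_wpM2r ?invr_ge0.
apply: (@dvg_harmonic R); apply: bsum_cvg; first exact: harmonic_ge0.
have [M hM] := hs; exists (1 + M) => -[|n].
  by rewrite big_ord0; have := hM 0%N; rewrite big_ord0; lra.
by rewrite big_ord_recl /harmonic /= invr1 lerD2l; exact: hM.
Qed.

Lemma bsum_cst_inv_sqr C : bsum (fun n => C * n.+2%:R ^- 2 : R).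
Proof.
have [C0|C0] := leP 0 C; first exact: bsumZ bsum_inv_sqr.
by apply: (@bsum_near_le0 _ 0%N) => n _; rewrite nmulr_rle0// invr_ge0 sqr_ge0.
Qed.

End BoundedSums.

(** * The chain of walks *)

Section Paths.
Context {R : realType}.
Implicit Types (l : seq int) (m : nat).

Definition letters : seq int := [:: 1; -1; 0].

(** Index [m] stands for time m + 2, since the recursion starts after X_1 and X_2. These two steps
    are nonzero, which gives the lower bound on the counts and keeps N - 1 positive in [escape]. *)
Definition path_ok m l :=
  [&& size l == m.+2, all (mem letters) l &
      (2 <= count (fun y => y == 1%R) l + count (fun y => y == (-1)%R) l)%N].

Lemma path_ok_rcons m l x :
  x \in letters -> path_ok m l -> path_ok m.+1 (rcons l x).
Proof.
move=> xl /and3P[/eqP sl al cl]; apply/and3P; split.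
- by rewrite size_rcons sl.
- by rewrite all_rcons al andbT.
- by rewrite -cats1 !count_cat /= (leq_trans cl)// leq_add ?leq_addr.
Qed.

Lemma count_letters l : all (mem letters) l ->
  (count (fun y => y == 1%R) l + count (fun y => y == (-1)%R) l
   + count (fun y => y == 0%R) l)%N = size l.
Proof.
elim: l => //= x l IHl /andP[xl /IHl <-]; move: xl.
by rewrite /= !inE => /or3P[] /eqP-> /=; lia.
Qed.

Definition freq (x : int) l : R := (count (fun y => y == x) l)%:R / (size l)%:R.

Lemma freq_ge0 x l : 0 <= freq x l.
Proof. by rewrite /freq divr_ge0. Qed.

Lemma freq_le1 m l : path_ok m l -> freq 1 l + freq (-1) l <= 1.
Proof.
case/and3P => /eqP sl al _; rewrite /freq -mulrDl ler_pdivrMr ?sl ?ltr0n//.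
by rewrite mul1r -natrD ler_nat -sl -(count_letters al) leq_addr.
Qed.

Definition posn l : R :=
  (count (fun y => y == 1%R) l)%:R - (count (fun y => y == (-1)%R) l)%:R.
Definition moves l : R :=
  (count (fun y => y == 1%R) l)%:R + (count (fun y => y == (-1)%R) l)%:R.

Definition on_state (f : R -> R -> R -> R) l : R := f (size l)%:R (posn l) (moves l).

Lemma path_ok_state m l : path_ok m l ->
  [/\ (size l)%:R = m.+2%:R :> R, 2 <= moves l, moves l <= m.+2%:R &
      `|posn l| <= moves l].
Proof.
case/and3P => /eqP sl al cl; split.
- by rewrite sl.
- by rewrite /moves -natrD ler_nat.
- by rewrite /moves -natrD ler_nat -sl -(count_letters al) leq_addr.
- rewrite ler_norml /posn /moves.
  by apply/andP; split; rewrite -subr_ge0; [rewrite opprK|];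
    set a := _%:R; set b := _%:R;
    have a0 : 0 <= a by []; have b0 : 0 <= b by []; lra.
Qed.

End Paths.

Section Chain.
Context {R : realType} (p : R).
Hypothesis p01 : 0 < p < 1.
Implicit Types (l : seq int) (g : seq int -> R) (m : nat).

(* Probability of a [+1] step when the frequencies of [+1] and [-1] in the past
   are [x] and [y]; the probability of a [-1] step is [up_prob y x]. *)
Definition up_prob (x y : R) : R :=
  (1 - ((1 - p) * x + p * y)) ^+ 2 - (1 - x - y) ^+ 2.

Definition step_mean g l : R :=
  up_prob (freq 1 l) (freq (-1) l) * g (rcons l 1) +
  up_prob (freq (-1) l) (freq 1 l) * g (rcons l (-1)) +
  (1 - up_prob (freq 1 l) (freq (-1) l) - up_prob (freq (-1) l) (freq 1 l))
    * g (rcons l 0).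

(* [law m g] is the mean of [g] over the first [m.+2] steps of the walk. *)
Fixpoint law m g : R :=
  if m is m'.+1 then law m' (step_mean g)
  else (g [:: 1; 1] + g [:: 1; -1] + g [:: -1; 1] + g [:: -1; -1]) / 4.

(** One channel gives +1 with probability u = p x + (1 - p) y and 0 with probability v = 1 - x - y.
    The clipped sum is +1 when both channels give +1, or one gives +1 and the other 0: this is the
    factorisation u (2 v + u). *)
Lemma up_prob_ge0 x y : 0 <= x -> 0 <= y -> x + y <= 1 -> 0 <= up_prob x y.
Proof.
move=> x0 y0 xy; case/andP: p01 => p0 p1.
have -> : up_prob x y = (p * x + (1 - p) * y) *
    ((1 - x - y) *+ 2 + (p * x + (1 - p) * y)) by rewrite /up_prob; ring.
have h : 0 <= p * x + (1 - p) * y by rewrite addr_ge0 ?mulr_ge0//; lra.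
by rewrite mulr_ge0// addr_ge0// mulrn_wge0//; lra.
Qed.

Lemma up_prob_sum_le1 x y : 0 <= x -> 0 <= y -> x + y <= 1 ->
  0 <= 1 - up_prob x y - up_prob y x.
Proof.
move=> x0 y0 xy; case/andP: p01 => p0 p1; have -> : 1 - up_prob x y - up_prob y x = (1 - x - y) ^+ 2
  + 2 * (p * x + (1 - p) * y) * (p * y + (1 - p) * x) by rewrite /up_prob; ring.
by rewrite addr_ge0 ?sqr_ge0// !mulr_ge0// addr_ge0 ?mulr_ge0//; lra.
Qed.

Lemma step_mean_le m l g g' : path_ok m l ->
  (forall l', path_ok m.+1 l' -> g l' <= g' l') ->
  step_mean g l <= step_mean g' l.
Proof.
move=> lok gg'; have xy := @freq_le1 R _ _ lok.
have x0 := @freq_ge0 R 1 l; have y0 := @freq_ge0 R (-1) l.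
rewrite /step_mean !lerD// ler_wpM2l ?up_prob_ge0 ?up_prob_sum_le1// 1?addrC//.
- exact/gg'/path_ok_rcons.
- exact/gg'/path_ok_rcons.
- exact/gg'/path_ok_rcons.
Qed.

Lemma law_le m g g' : (forall l, path_ok m l -> g l <= g' l) -> law m g <= law m g'.
Proof.
elim: m g g' => [|m IHm] g g' gg' /=.
  by rewrite ler_wpM2r// !lerD// gg'.
by apply: IHm => l lok; exact: step_mean_le gg'.
Qed.

Lemma eq_law m g g' : (forall l, path_ok m l -> g l = g' l) -> law m g = law m g'.
Proof. by move=> h; apply/eqP; rewrite eq_le !law_le// => l /h ->. Qed.

Lemma lawD m g g' : law m (fun l => g l + g' l) = law m g + law m g'.
Proof.
elim: m g g' => [|m IHm] g g' /=; first by field.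
by rewrite -IHm; apply: eq_law => l _; rewrite /step_mean; ring.
Qed.

Lemma lawZ m x g : law m (fun l => x * g l) = x * law m g.
Proof.
elim: m g => [|m IHm] g /=; first by field.
by rewrite -IHm; apply: eq_law => l _; rewrite /step_mean; ring.
Qed.

Lemma law_cst m x : law m (fun=> x) = x.
Proof.
elim: m => [|m IHm] /=; first by field.
by rewrite -[RHS]IHm; apply: eq_law => l _; rewrite /step_mean; ring.
Qed.

Lemma law_sum m (I : Type) (r : seq I) (F : I -> seq int -> R) :
  law m (fun l => \sum_(i <- r) F i l) = \sum_(i <- r) law m (F i).
Proof.
elim: r => [|i r IHr].
  by rewrite big_nil -[RHS](law_cst m 0); apply: eq_law => l _; rewrite big_nil.
rewrite big_cons -IHr -lawD; apply: eq_law => l _.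
by rewrite big_cons.
Qed.

Definition drift_pos (n S N : R) := (2 * p - 1) * (S / n) * (2 - N / n).
Definition move_prob (n S N : R) :=
  2 * (N / n) - 3 / 2 * (N / n) ^+ 2 + (2 * p - 1) ^+ 2 / 2 * (S / n) ^+ 2.

(** For a step x in {1, -1, 0} the three bounds say that the new value is at most A + B x + C x^2,
    and [drift_pos] and [move_prob] are the conditional means of x and x^2. *)
Lemma step_mean_on_state m l (f : R -> R -> R -> R) : path_ok m l ->
  let n := (size l)%:R in let S := posn l in let N := moves l in
  forall A B C : R,
  f (n + 1) (S + 1) (N + 1) <= A + B + C ->
  f (n + 1) (S - 1) (N + 1) <= A - B + C ->
  f (n + 1) S N <= A ->
  step_mean (on_state f) l <= A + B * drift_pos n S N + C * move_prob n S N.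
Proof.
move=> lok n S N A B C h1 h2 h3; have xy := @freq_le1 R _ _ lok.
have x0 := @freq_ge0 R 1 l; have y0 := @freq_ge0 R (-1) l.
have n0 : n != 0 by rewrite /n; case/and3P: lok => /eqP -> _ _; rewrite pnatr_eq0.
have -> : A + B * drift_pos n S N + C * move_prob n S N =
  up_prob (freq 1 l) (freq (-1) l) * (A + B + C) +
  up_prob (freq (-1) l) (freq 1 l) * (A - B + C) +
  (1 - up_prob (freq 1 l) (freq (-1) l) - up_prob (freq (-1) l) (freq 1 l)) * A.
  rewrite /drift_pos /move_prob /up_prob /freq /S /N /posn /moves -/n.
  by field.
rewrite /step_mean /on_state /posn /moves !size_rcons -!cats1 !count_cat /= !addn0.
rewrite !natrD -[(size l).+1%:R]natr1 -/n -!/(posn l) -!/(moves l).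
rewrite !lerD// ler_wpM2l ?up_prob_ge0 ?up_prob_sum_le1// 1?addrC//.
- apply: le_trans h1; rewrite le_eqVlt; apply/orP; left; apply/eqP.
  by congr (f _ _ _); rewrite /S /N /posn /moves; ring.
- apply: le_trans h2; rewrite le_eqVlt; apply/orP; left; apply/eqP.
  by congr (f _ _ _); rewrite /S /N /posn /moves; ring.
Qed.

Lemma law_step m (f g : R -> R -> R -> R) :
  (forall n S N, n = m.+2%:R -> 2 <= N -> N <= n -> `|S| <= N ->
   exists A B C, [/\ f (n + 1) (S + 1) (N + 1) <= A + B + C,
     f (n + 1) (S - 1) (N + 1) <= A - B + C, f (n + 1) S N <= A &
     A + B * drift_pos n S N + C * move_prob n S N <= g n S N]) ->
  law m.+1 (on_state f) <= law m (on_state g).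
Proof.
move=> h /=; apply: law_le => l lok; have [sl N2 Nn SN] := @path_ok_state R _ _ lok.
have [|||A [B [C [h1 h2 h3 h4]]]] := h (size l)%:R (posn l) (moves l) sl => //.
  by rewrite sl.
exact: le_trans (step_mean_on_state lok h1 h2 h3) h4.
Qed.

(** Exchanging +1 and -1 preserves the initial law and swaps the arguments of [up_prob], hence the
    two step probabilities. *)
Lemma law_sym m (f : R -> R -> R -> R) :
  law m (on_state f) = law m (on_state (fun n S N => f n (- S) N)).
Proof.
suff h : forall g g', (forall l, g l = g' (map -%R l)) -> law m g = law m g'.
  apply: h => l; rewrite /on_state size_map /posn /moves !count_map.
  have e1 : count (preim -%R (fun y : int => y == 1)) l = count (fun y => y == -1) l.
    by apply: eq_count => y /=; rewrite eqr_oppLR.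
  have e2 : count (preim -%R (fun y : int => y == -1)) l = count (fun y => y == 1) l.
    by apply: eq_count => y /=; rewrite eqr_opp.
  by rewrite e1 e2; congr (f _ _ _); ring.
elim: m => [|m IHm] g g' gg' /=.
  rewrite !gg' /= !opprK; ring.
apply: IHm => l; rewrite /step_mean !gg' !map_rcons opprK oppr0 /freq size_map.
rewrite !count_map.
have e1 : count (preim -%R (fun y : int => y == 1)) l = count (fun y => y == -1) l.
  by apply: eq_count => y /=; rewrite eqr_oppLR.
have e2 : count (preim -%R (fun y : int => y == -1)) l = count (fun y => y == 1) l.
  by apply: eq_count => y /=; rewrite eqr_opp.
by rewrite e1 e2; ring.
Qed.

End Chain.

(** * Lyapunov functions *)

Section Escape.
Context {R : realType} (p : R).

(** This is (W - 2)_+^2 / W for W = n / M, M = N - 1. After a nonzero step the denominator contains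
    M + 1 = N, and the lower bound on the move probability is proportional to N: the shift by one
    makes the two factors cancel. *)
Definition escape (n S N : R) : R := Num.max 0 (n - 2 * (N - 1)) ^+ 2 / (n * (N - 1)).

Lemma move_prob_ge (n S N : R) :
  2 * (N / n) - 3 / 2 * (N / n) ^+ 2 <= move_prob p n S N.
Proof. by rewrite /move_prob lerDl mulr_ge0 ?sqr_ge0// divr_ge0 ?sqr_ge0. Qed.

Lemma escape_ge0 (n S N : R) : 0 <= n -> 2 <= N -> 0 <= escape n S N.
Proof. by move=> n0 N2; rewrite divr_ge0 ?sqr_ge0// mulr_ge0//; lra. Qed.

Lemma escape_step (n S N : R) : 40 <= n -> 2 <= N ->
  exists A B C, [/\ escape (n + 1) (S + 1) (N + 1) <= A + B + C,
     escape (n + 1) (S - 1) (N + 1) <= A - B + C, escape (n + 1) S N <= A &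
     A + B * drift_pos p n S N + C * move_prob p n S N
       <= escape n S N - 20^-1 * (escape n S N / n) + 4 * n ^- 2].
Proof.
move=> n40 N2; rewrite /escape addrK.
pose M := N - 1; rewrite -!/M; have EN : N = M + 1 by rewrite subrK.
pose D := n - 2 * M.
have M1 : 1 <= M by rewrite /M; lra.
have -> : n + 1 - 2 * N = D - 1 by rewrite /D EN; ring.
have -> : n + 1 - 2 * M = D + 1 by rewrite /D; ring.
rewrite -/D EN.
have n0 : 0 < n by lra.
have nn0 : n != 0 by rewrite gt_eqF.
have M0 : M != 0 by rewrite gt_eqF//; lra.
have n10 : n + 1 != 0 by rewrite gt_eqF//; lra.
have M10 : M + 1 != 0 by rewrite gt_eqF//; lra.
have [D0|D0] : D <= 0 \/ 0 < D by case: (leP D 0) => _; [left|right].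
  (* Here the function vanishes, and D + 1 <= 1 bounds what it can become in one step. As M >= n /
     2, the new value is of order 1 / n^2. *)
  exists ((n + 1) * M)^-1, 0, 0.
  have m1 : Num.max 0 (D - 1) = 0 by apply/max_l; lra.
  have m2 : Num.max 0 D = 0 by exact/max_l.
  have iM : 0 <= ((n + 1) * M)^-1 by rewrite invr_ge0 mulr_ge0//; lra.
  rewrite m1 m2 expr0n /= !mul0r !addr0 !subr0 mulr0 subr0 add0r; split => //.
    rewrite -[leRHS]mul1r ler_wpM2r// expr_le1//; last by rewrite le_max lexx.
    by rewrite ge_max; apply/andP; split; lra.
  have -> : 4 * n ^- 2 = (n ^+ 2 / 4)^-1 by field.
  have e1 : 0 < n ^+ 2 / 4 by rewrite divr_gt0 ?exprn_gt0.
  have e2 : 0 < (n + 1) * M by rewrite mulr_gt0//; lra.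
  rewrite lef_pV2 ?posrE//.
  by rewrite /D in D0; nra.
have mD : Num.max 0 D = D by apply/max_r/ltW.
have mD1 : Num.max 0 (D + 1) = D + 1 by apply/max_r; lra.
have mDm : Num.max 0 (D - 1) ^+ 2 <= (D - 1) ^+ 2.
  have [h|h] := leP 0 (D - 1); first by rewrite lexx.
  by rewrite expr0n sqr_ge0.
pose A := (D + 1) ^+ 2 / ((n + 1) * M).
pose C := (D - 1) ^+ 2 / ((n + 1) * (M + 1)) - A.
have AC : A + C = (D - 1) ^+ 2 / ((n + 1) * (M + 1)) by rewrite /C addrC subrK.
exists A, 0, C; rewrite mD mD1 subr0 addr0 AC mul0r addr0.
have iM : 0 <= ((n + 1) * (M + 1))^-1 by rewrite invr_ge0 mulr_ge0//; lra.
split; [exact: ler_wpM2r|exact: ler_wpM2r|exact: lexx|].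
(* 6/5 = 2 - (3/2)(8/15): for t <= 8/15, which follows from D > 0 and n >= 40, the move probability
   is at least 6 t / 5. A factor above 1 makes N grow, in relative terms, faster than n. *)
pose th : R := 6 / 5.
have P1 : th * (M + 1) / n <= move_prob p n S (M + 1).
  apply: le_trans (move_prob_ge _ _ _).
  pose t := (M + 1) / n; rewrite -mulrA -/t.
  have t0 : 0 <= t by rewrite divr_ge0//; lra.
  have t1 : t <= 8 / 15 by rewrite /t ler_pdivrMr//; move: D0; rewrite /D; lra.
  by rewrite /th; nra.
have C0 : C <= 0.
  rewrite subr_le0 ler_pdivrMr ?mulr_gt0//; try lra.
  rewrite /A mulrAC ler_pdivlMr ?mulr_gt0//; try lra.
  have : (D - 1) ^+ 2 * M <= (D + 1) ^+ 2 * (M + 1).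
    by apply: ler_pM; rewrite ?sqr_ge0//; [lra|nra|lra].
  move=> h; have : 0 <= n + 1 by lra.
  by move=> /ler_wpM2l /(_ _ _ h); lra.
apply: (@le_trans _ _ (A + C * (th * (M + 1) / n))).
  by rewrite lerD2l ler_wnM2l.
pose E := (D + 1) ^+ 2 - th / n * (4 * D * M + (D + 1) ^+ 2).
have -> : A + C * (th * (M + 1) / n) = E / (M * (n + 1)).
  by rewrite /C /A /E; field; rewrite M0 nn0 n10 M10.
have -> : D ^+ 2 / (n * M) - 20^-1 * (D ^+ 2 / (n * M) / n) + 4 * n ^- 2 =
    (D ^+ 2 * (n + 1) * (1 - 20^-1 / n) + 4 * M * (n + 1) / n) / n / (M * (n + 1)).
  by field; rewrite M0 nn0 n10.
rewrite ler_wpM2r ?invr_ge0 ?mulr_ge0//; try lra.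
rewrite ler_pdivlMr//.
have -> : E * n = D ^+ 2 * n + (2 * D + 1) * n - th * (4 * D * M + (D + 1) ^+ 2).
  by rewrite /E; field.
have -> : 4 * D * M = 2 * D * (n - D) by rewrite /D; field.
have i0 : 0 <= n^-1 by rewrite invr_ge0 ltW.
have i1 : n^-1 <= 40^-1 by rewrite lef_pV2 ?posrE//.
have : 4 * M <= 4 * M * (n + 1) / n.
  by rewrite ler_pdivlMr// ler_wpM2l//; lra.
have : D ^+ 2 * (n + 9 / 10) <= D ^+ 2 * (n + 1) * (1 - 20^-1 / n).
  rewrite -mulrA ler_wpM2l ?sqr_ge0//.
  have -> : (n + 1) * (1 - 20^-1 / n) = n + 1 - 20^-1 - 20^-1 / n by field.
  lra.
have : n <= 10^-1 * D ^+ 2 + 4 * M.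
  by have [h|h] := leP (n / 4) M; have := sqr_ge0 D; rewrite /D in D0 *; nra.
have : D ^+ 2 <= D * n by rewrite expr2 ler_wpM2l//; [exact: ltW|rewrite /D; lra].
by rewrite /th; nra.
Qed.

End Escape.

(** * The noise keeps S away from 0 *)

Section Lyapunov.
Context {R : realType} (p : R).
Let q : R := 2 * p - 1.

Definition state_ok (n S N : R) := [/\ 2 <= n, 2 <= N, N <= n & `|S| <= N].

Lemma state_freq (n S N : R) : state_ok n S N ->
  [/\ 0 <= N / n, N / n <= 1, (S / n) ^+ 2 <= (N / n) ^+ 2, -1 <= S / n & S / n <= 1].
Proof.
move=> [n2 N2 Nn SN]; have n0 : 0 < n by lra.
have t0 : 0 <= N / n by rewrite divr_ge0//; lra.
have t1 : N / n <= 1 by rewrite ler_pdivrMr// mul1r.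
have s1 : `|S / n| <= N / n by rewrite normf_div (gtr0_norm n0) ler_wpM2r// invr_ge0 ltW.
have [s2 s3] : - (N / n) <= S / n /\ S / n <= N / n by apply/andP; rewrite -ler_norml.
split => //; [|lra|lra].
by rewrite -[leLHS]real_normK ?num_real// lerXn2r// nnegrE.
Qed.

Lemma sqr_q_le1 : 0 < p < 1 -> q ^+ 2 <= 1.
Proof.
case/andP => p0 p1; have : 0 <= (1 - q) * (1 + q) by apply: mulr_ge0; rewrite /q; lra.
by rewrite -subr_ge0 expr2; lra.
Qed.

Lemma move_prob_bounds (n S N : R) : 0 < p < 1 -> state_ok n S N ->
  [/\ 0 <= move_prob p n S N & move_prob p n S N <= 1].
Proof.
move=> p01 /state_freq[t0 t1 s2 _ _].
split.
  by apply: le_trans (move_prob_ge _ _ _ _); nra.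
rewrite /move_prob.
have q1 := sqr_q_le1 p01; have q0 : 0 <= q ^+ 2 by exact: sqr_ge0.
have : q ^+ 2 / 2 * (S / n) ^+ 2 <= 1 / 2 * (N / n) ^+ 2.
  by apply: ler_pM => //; rewrite ?sqr_ge0//; lra.
by rewrite /q; move: (N / n) t0 t1 {s2} => t t0 t1; nra.
Qed.

(** The exact remainder is D^2 / (Q^2 (Q + D)), and the second hypothesis bounds 1 / (Q + D) by 2 /
    Q. *)
Lemma inv_taylor (Q D : R) : 0 < Q -> Q / 2 <= Q + D ->
  (Q + D)^-1 <= Q^-1 - D * Q^-1 ^+ 2 + 2 * D ^+ 2 * Q^-1 ^+ 3.
Proof.
move=> Q0 QD; have QD0 : 0 < Q + D by lra.
have -> : (Q + D)^-1 = Q^-1 - D * Q^-1 ^+ 2 + D ^+ 2 * Q^-1 ^+ 2 * (Q + D)^-1.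
  by field; rewrite !gt_eqF.
rewrite lerD2l.
have -> : 2 * D ^+ 2 * Q^-1 ^+ 3 = D ^+ 2 * Q^-1 ^+ 2 * (Q / 2)^-1.
  by field; rewrite gt_eqF.
by rewrite ler_wpM2l ?(mulr_ge0 (sqr_ge0 _) (sqr_ge0 _))// lef_pV2// posrE//; lra.
Qed.

(** Apply ln (1 + x) <= x to x = Q / (Q + D) - 1 and expand this x with the same control of the
    remainder. *)
Lemma ln_taylor (Q D : R) : 0 < Q -> Q / 2 <= Q + D ->
  - ln (Q + D) <= - ln Q - D * Q^-1 + 2 * D ^+ 2 * Q^-1 ^+ 2.
Proof.
move=> Q0 QD; have QD0 : 0 < Q + D by lra.
have : ln (Q / (Q + D)) <= Q / (Q + D) - 1.
  have := @le_ln1Dx R (Q / (Q + D) - 1); rewrite subrKC; apply.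
  by rewrite ltrBrDl subrr divr_gt0.
rewrite ln_div ?posrE// => h.
suff : Q / (Q + D) - 1 <= - D * Q^-1 + 2 * D ^+ 2 * Q^-1 ^+ 2 by lra.
have -> : Q / (Q + D) - 1 = - D * Q^-1 + D ^+ 2 * Q^-1 * (Q + D)^-1.
  by field; rewrite !gt_eqF.
rewrite lerD2l.
have -> : 2 * D ^+ 2 * Q^-1 ^+ 2 = D ^+ 2 * Q^-1 * (Q / 2)^-1.
  by field; rewrite gt_eqF.
have D2 : 0 <= D ^+ 2 * Q^-1 by rewrite (mulr_ge0 (sqr_ge0 _)) ?invr_ge0 ?ltW.
by rewrite ler_wpM2l// lef_pV2// posrE//; lra.
Qed.

(* Any constant large enough to make the drift of [spread] negative would do
   instead of [128]. *)
Definition quad (n S : R) := S ^+ 2 + 128 * n.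
Definition spread (n S N : R) := n / quad n S.

Lemma quad_bounds (n S : R) : 2 <= n ->
  [/\ 0 < quad n S, quad n S / 2 <= quad n S + (129 + 2 * S),
      quad n S / 2 <= quad n S + (129 - 2 * S) & quad n S / 2 <= quad n S + 128].
Proof. by move=> n2; rewrite /quad; split; nra. Qed.

Lemma quadS (n S : R) : [/\ quad (n + 1) (S + 1) = quad n S + (129 + 2 * S),
  quad (n + 1) (S - 1) = quad n S + (129 - 2 * S) & quad (n + 1) S = quad n S + 128].
Proof. by rewrite /quad; split; ring. Qed.

Lemma quad_inv_bounds (n S : R) : 2 <= n -> let y := (quad n S)^-1 in
  [/\ 0 < y, n * y <= 128^-1, S ^+ 2 * y = 1 - 128 * (n * y) & y = spread n S 0 / n].
Proof.
move=> n2 y; have [Q0 _ _ _] := quad_bounds S n2.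
have n0 : 0 < n by lra.
have Q1 : quad n S != 0 by rewrite gt_eqF.
split.
- by rewrite invr_gt0.
- rewrite ler_pdivrMr// ler_pdivlMl// /quad; have := sqr_ge0 S; lra.
- have -> : S ^+ 2 = quad n S - 128 * n by rewrite /quad; ring.
  by rewrite /y; field.
- by rewrite /spread /y mulrAC divff ?mul1r// gt_eqF.
Qed.

(** When t <= 1/3 one has W >= 3, and (W - 2)^2 / W is at least its value 1/3 at W = 3. This lets
    [escape] pay wherever an estimate fails for small t. *)
Lemma escape_ge_third (n S N : R) : state_ok n S N -> N / n <= 1 / 3 ->
  1 / 3 <= escape n S N.
Proof.
move=> [n2 N2 Nn SN]; have n0 : 0 < n by lra.
rewrite ler_pdivrMr// => h; rewrite /escape.
have -> : Num.max 0 (n - 2 * (N - 1)) = n - 2 * (N - 1) by apply/max_r; lra.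
rewrite ler_pdivlMr ?mulr_gt0//; try lra.
by nra.
Qed.

(** Here z is [spread], u = S^2 / n, i = 1 / n, m = q (2 - t). The factor 1 + i due to the growth of
    n is offset by z^2 (128 + u) = z. Since 2 m u >= 3 u / 2, the surplus over u absorbs 16 u P1 z
    <= u / 8 and leaves the decrease z^2 (P1 + 3 u / 8). This dominates z / 256 if P1 >= 1/2;
    otherwise e >= 1/3 exceeds z / 256. *)
Lemma spread_algebra (z u i P1 m e : R) : 0 < z -> z * (128 + u) = 1 ->
  z <= 128^-1 -> 0 <= u -> 0 < i -> i <= 1 / 2 -> 0 <= P1 -> P1 <= 1 ->
  3 / 4 <= m -> 0 <= e -> 1 / 3 <= e \/ 1 / 2 <= P1 ->
  (1 + i) * (z - i * z ^+ 2 * (128 + P1 + 2 * m * u - 16 * u * P1 * z)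
    + 4 * 129 ^+ 2 * z ^+ 3 * i ^+ 2) <= z - i * (256^-1 * z - e) + i ^+ 2.
Proof.
move=> z0 uz z1 u0 i0 i1 P0 P11 m34 e0 eP.
have zz : z ^+ 2 * (128 + u) = z by rewrite expr2 -mulrA uz mulr1.
have z2 : 0 <= z ^+ 2 by exact: sqr_ge0.
have k1 : 16 * u * P1 * z <= u / 8.
  have : u * P1 * z <= u * 1 * 128^-1.
    by apply: ler_pM; [exact: mulr_ge0|exact: ltW|exact: ler_wpM2l|exact: z1].
  lra.
have k2 : (3 / 4) * u <= m * u by rewrite ler_wpM2r.
have k3 : z + z ^+ 2 * (P1 + 3 / 8 * u)
    <= z ^+ 2 * (128 + P1 + 2 * m * u - 16 * u * P1 * z).
  rewrite -[X in X + _]zz -mulrDr ler_wpM2l//; lra.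
have k4 : 256^-1 * z - e <= z ^+ 2 * (P1 + 3 / 8 * u).
  have [h|h] := eP.
    have : 0 <= z ^+ 2 * (P1 + 3 / 8 * u) by rewrite mulr_ge0// addr_ge0// mulr_ge0.
    by lra.
  rewrite -[in leLHS]zz; have : 256^-1 * (z ^+ 2 * (128 + u)) <= z ^+ 2 * (P1 + 3 / 8 * u).
    by rewrite mulrCA ler_wpM2l//; lra.
  lra.
have k5 : 4 * 129 ^+ 2 * z ^+ 3 <= 1 / 2.
  have : z ^+ 3 <= 128^-1 ^+ 3 by rewrite lerXn2r// ?nnegrE// ltW.
  lra.
apply: (@le_trans _ _ ((1 + i) * (z - i * (z + z ^+ 2 * (P1 + 3 / 8 * u)) + 1 / 2 * i ^+ 2))).
  rewrite ler_wpM2l//; first lra.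
  rewrite lerD//; last by rewrite ler_wpM2r// sqr_ge0.
  by rewrite lerD2l lerN2 -[i * _ * _]mulrA ler_wpM2l// ltW.
set G := z ^+ 2 * _ in k4 *; have G0 : 0 <= G by rewrite mulr_ge0// addr_ge0// mulr_ge0.
have k6 : i * (256^-1 * z - e) <= i * G by rewrite ler_wpM2l// ltW.
have k7 : 0 <= i ^+ 2 * G by rewrite mulr_ge0// sqr_ge0.
have k8 : 0 <= i ^+ 2 * z by rewrite mulr_ge0// ?sqr_ge0// ltW.
have k9 : i ^+ 2 * i <= i ^+ 2 * (1 / 2) by rewrite ler_wpM2l// sqr_ge0.
have -> : (1 + i) * (z - i * (z + G) + 1 / 2 * i ^+ 2) =
  z - i * G - i ^+ 2 * z - i ^+ 2 * G + 1 / 2 * i ^+ 2 + 1 / 2 * (i ^+ 2 * i) by ring.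
have : 0 <= i ^+ 2 by exact: sqr_ge0.
lra.
Qed.

Lemma spread_step (n S N : R) : 0 < p < 1 -> 3 / 4 <= q -> state_ok n S N ->
  exists A B C, [/\ spread (n + 1) (S + 1) (N + 1) <= A + B + C,
     spread (n + 1) (S - 1) (N + 1) <= A - B + C, spread (n + 1) S N <= A &
     A + B * drift_pos p n S N + C * move_prob p n S N
       <= spread n S N - 256^-1 * (spread n S N / n) + escape n S N / n + n ^- 2].
Proof.
move=> p01 q34 Sok; have [n2 N2 Nn SN] := Sok; have n0 : 0 < n by lra.
have [Q0 h1 h2 h3] := quad_bounds S n2; have [E1 E2 E3] := quadS n S.
have [y0 ny Sy _] := quad_inv_bounds S n2.
have [t0 t1 st s0 s1] := state_freq Sok.
have [P0 P1] := move_prob_bounds p01 Sok.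
set y := (quad n S)^-1 in y0 ny Sy.
(* A step x changes [quad] by D = 128 + 2 S x + x^2, and D^2 <= 2 129^2 + 8 S^2 x^2. Inserting this
   in [inv_taylor] and sorting by 1, x, x^2 gives the three coefficients. *)
pose A := (n + 1) * (y - 128 * y ^+ 2 + 4 * 129 ^+ 2 * y ^+ 3).
pose B := (n + 1) * (- 2 * S * y ^+ 2).
pose C := (n + 1) * (- y ^+ 2 + 16 * S ^+ 2 * y ^+ 3).
have y3 : 0 <= y ^+ 3 by rewrite exprn_ge0// ltW.
have n10 : 0 <= n + 1 by lra.
have sqD : (129 + 2 * S) ^+ 2 <= 2 * 129 ^+ 2 + 8 * S ^+ 2.
  by rewrite -subr_ge0 (_ : _ - _ = (129 - 2 * S) ^+ 2) ?sqr_ge0//; ring.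
have sqB : (129 - 2 * S) ^+ 2 <= 2 * 129 ^+ 2 + 8 * S ^+ 2.
  by rewrite -subr_ge0 (_ : _ - _ = (129 + 2 * S) ^+ 2) ?sqr_ge0//; ring.
exists A, B, C; rewrite /spread E1 E2 E3; split.
- have -> : A + B + C = (n + 1) * (y - (129 + 2 * S) * y ^+ 2 +
     2 * (2 * 129 ^+ 2 + 8 * S ^+ 2) * y ^+ 3) by rewrite /A /B /C; ring.
  apply: ler_wpM2l; [exact: n10|apply: (le_trans (inv_taylor Q0 h1))].
  by rewrite lerD2l ler_wpM2r// ler_wpM2l.
- have -> : A - B + C = (n + 1) * (y - (129 - 2 * S) * y ^+ 2 +
     2 * (2 * 129 ^+ 2 + 8 * S ^+ 2) * y ^+ 3) by rewrite /A /B /C; ring.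
  apply: ler_wpM2l; [exact: n10|apply: (le_trans (inv_taylor Q0 h2))].
  by rewrite lerD2l ler_wpM2r// ler_wpM2l.
- rewrite /A; apply: ler_wpM2l; [exact: n10|apply: (le_trans (inv_taylor Q0 h3))].
  by rewrite lerD2l ler_wpM2r//; clear -p q; lra.
set P1' := move_prob p n S N in P0 P1 *.
rewrite -/y.
pose u := S ^+ 2 / n; pose z := n * y.
have u0 : 0 <= u by rewrite divr_ge0 ?sqr_ge0// ltW.
have z0 : 0 < z by rewrite mulr_gt0.
have uz : z * (128 + u) = 1.
  rewrite /z /u; have -> : n * y * (128 + S ^+ 2 / n) = 128 * (n * y) + S ^+ 2 * y.
    by field; rewrite gt_eqF.
  by rewrite Sy; ring.
pose i := n^-1; have i0 : 0 < i by rewrite invr_gt0.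
have i1 : i <= 1 / 2 by rewrite /i div1r lef_pV2 ?posrE.
have ni : n * i = 1 by rewrite mulfV// gt_eqF.
pose m := q * (2 - N / n); have m34 : 3 / 4 <= m.
  by rewrite /m; move: (N / n) t1 => t t1; clear -p q q34 t1; nra.
have -> : A + B * drift_pos p n S N + C * P1' =
  (1 + i) * (z - i * z ^+ 2 * (128 + P1' + 2 * m * u - 16 * u * P1' * z)
    + 4 * 129 ^+ 2 * z ^+ 3 * i ^+ 2).
  by rewrite /A /B /C /drift_pos /m /q /z /u /i; field; rewrite gt_eqF.
have -> : n * y - 256^-1 * (n * y / n) + escape n S N / n + n ^- 2 =
   z - i * (256^-1 * z - escape n S N) + i ^+ 2.
  by rewrite /z /i; field; rewrite gt_eqF.
apply: spread_algebra => //; first exact: escape_ge0 (ltW n0) N2.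
have [h|h] := leP (N / n) (1 / 3); [left; exact: escape_ge_third|right].
apply: le_trans (move_prob_ge _ _ _ _).
by move: (N / n) h t1 => t h t1; clear -p q h t1; nra.
Qed.

End Lyapunov.

(** Mean change of [log_lyap] with h = 1 / (n + 1), i = 1 / n, z = [spread], so that z i is the
    inverse of [quad]. The two equations on T and r say that t = T, s^2 = r is an equilibrium of the
    flow. *)
Lemma log_lyap_algebra (R : realType) (q T r s t h i z P1 m : R) : 0 <= q -> q <= 1 -> 0 <= r ->
  q * (2 - T) = 1 -> T - 3 / 2 * T ^+ 2 + q ^+ 2 / 2 * r = 0 ->
  P1 = 2 * t - 3 / 2 * t ^+ 2 + q ^+ 2 / 2 * s ^+ 2 -> m = q * (2 - t) ->
  0 <= t -> t <= 1 -> 0 <= P1 -> P1 <= 1 -> 0 < h -> h <= i -> i <= 2 * h ->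
  i - h <= i ^+ 2 -> 0 <= z -> z <= 128^-1 -> 0 <= 3 / 2 * T - 1 ->
  q / 4 * (- 2 * s ^+ 2 * h + 4 * h ^+ 2 + 2 * m * s ^+ 2 * h
    + r * (2 * i - 128 * (z * i) + 4 * 129 ^+ 2 * (z * i) ^+ 2
       - 2 * m * ((1 - 128 * z) * i) - P1 * (z * i)
       + 16 * P1 * ((1 - 128 * z) * (z * i))))
  + (t - T) * h * (P1 - t) + h ^+ 2
  <= - ((3 / 2 * T - 1) / 2) * ((t - T) ^+ 2 * i) + 132 * r * (z * i) + (2 + 2 * r) * i ^+ 2.
Proof.
move=> q0 q1 r0 qT rT EP Em t0 t1 P0 P11 h0 hi ih ihh z0 z1 c0.
have i0 : 0 < i by apply: lt_le_trans hi.
have zi0 : 0 <= z * i by rewrite mulr_ge0// ltW.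
have i2 : 0 <= i ^+ 2 by exact: sqr_ge0.
have h2 : h ^+ 2 <= i ^+ 2 by rewrite lerXn2r// nnegrE ltW.
have m0 : 0 <= m by rewrite Em mulr_ge0//; clear -t1; lra.
have m2 : m <= 2.
  have : q * (2 - t) <= 1 * 2 by apply: ler_pM => //; clear -t0 t1; lra.
  by rewrite Em mul1r.
(* In the coefficient 528, the drift of the regularised logarithm contributes 256 m <= 512 and its
   second-order term 16. The weight q / 4 with q <= 1 later turns 528 into 132. *)
have a1 : 2 * i - 128 * (z * i) + 4 * 129 ^+ 2 * (z * i) ^+ 2
       - 2 * m * ((1 - 128 * z) * i) - P1 * (z * i)
       + 16 * P1 * ((1 - 128 * z) * (z * i)) <=
     2 * h * (1 - m) + 528 * (z * i) + 7 * i ^+ 2.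
  have b1 : 4 * 129 ^+ 2 * (z * i) ^+ 2 <= 5 * i ^+ 2.
    rewrite exprMn mulrA ler_wpM2r//.
    have : z ^+ 2 <= 128^-1 ^+ 2 by rewrite lerXn2r// nnegrE.
    by clear; lra.
  have b2 : m * (z * i) <= 2 * (z * i) by rewrite ler_wpM2r.
  have b3 : 0 <= P1 * (z * i) by rewrite mulr_ge0.
  have b4 : P1 * ((1 - 128 * z) * (z * i)) <= 1 * (1 * (z * i)).
    have d0 : 0 <= 1 - 128 * z by clear -z1; lra.
    apply: ler_pM => //; first by rewrite mulr_ge0.
    by rewrite ler_wpM2r//; clear -z0; lra.
  have b5 : 2 * (i - h) * (1 - m) <= 2 * i ^+ 2.
    have : (i - h) * (1 - m) <= (i - h) * 1.
      by rewrite ler_wpM2l//; [clear -hi; lra|clear -m0; lra].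
    by clear -ihh; lra.
  by clear -b1 b2 b3 b4 b5 zi0 i2; lra.
have a2 := ler_wpM2l r0 a1.
have q40 : 0 <= q / 4 by clear -q0; lra.
apply: (@le_trans _ _ (q / 4 * (- 2 * s ^+ 2 * h + 4 * h ^+ 2 + 2 * m * s ^+ 2 * h
   + r * (2 * h * (1 - m) + 528 * (z * i) + 7 * i ^+ 2))
   + (t - T) * h * (P1 - t) + h ^+ 2)).
  by rewrite !lerD2r ler_wpM2l// lerD2l.
have -> : q / 4 * (- 2 * s ^+ 2 * h + 4 * h ^+ 2 + 2 * m * s ^+ 2 * h
   + r * (2 * h * (1 - m) + 528 * (z * i) + 7 * i ^+ 2))
   + (t - T) * h * (P1 - t) + h ^+ 2 =
  h * (q / 2 * (m - 1) * (s ^+ 2 - r) + (t - T) * (P1 - t))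
   + q * (h ^+ 2 + r * (132 * (z * i)) + r * (7 / 4 * i ^+ 2)) + h ^+ 2 by field.
(* The logarithmic part yields -(q^2 / 2)(t - T)(s^2 - r) and the quadratic part its opposite. This
   cancellation fixes the weight q / 4 in [log_lyap]. *)
have -> : q / 2 * (m - 1) * (s ^+ 2 - r) + (t - T) * (P1 - t) =
   - ((t - T) ^+ 2 * (3 / 2 * (t + T) - 1)).
  have Em1 : m - 1 = - q * (t - T) by rewrite Em -[X in _ - X]qT; ring.
  have EPt : P1 - t = (t - T) * (1 - 3 / 2 * (t + T)) + q ^+ 2 / 2 * (s ^+ 2 - r).
    have -> : P1 - t = P1 - t - (T - 3 / 2 * T ^+ 2 + q ^+ 2 / 2 * r) by rewrite rT subr0.
    by rewrite EP; field.
  by rewrite Em1 EPt; field.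
have c1 : q * (h ^+ 2 + r * (132 * (z * i)) + r * (7 / 4 * i ^+ 2)) <=
   1 * (h ^+ 2 + r * (132 * (z * i)) + r * (7 / 4 * i ^+ 2)).
  rewrite ler_wpM2r//; apply: addr_ge0; last by apply: mulr_ge0 => //; exact: mulr_ge0.
  by apply: addr_ge0; [exact: sqr_ge0|apply: mulr_ge0 => //; exact: mulr_ge0].
have c2 : (3 / 2 * T - 1) * ((t - T) ^+ 2 * h) <= h * ((t - T) ^+ 2 * (3 / 2 * (t + T) - 1)).
  have -> : h * ((t - T) ^+ 2 * (3 / 2 * (t + T) - 1)) =
    (3 / 2 * (t + T) - 1) * ((t - T) ^+ 2 * h) by ring.
  rewrite ler_wpM2r ?(mulr_ge0 (sqr_ge0 _) (ltW h0))//.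
  by clear -t0; lra.
have c3 : (3 / 2 * T - 1) * ((t - T) ^+ 2 * i) <= (3 / 2 * T - 1) * ((t - T) ^+ 2 * (2 * h)).
  by rewrite !ler_wpM2l// sqr_ge0.
have c4 : 0 <= r * i ^+ 2 by rewrite mulr_ge0.
by clear -c1 c2 c3 c4 h2; lra.
Qed.

Section LogLyapunov.
Context {R : realType} (p : R).
Let q : R := 2 * p - 1.
Variables T r : R.

Definition log_lyap (n S N : R) :=
  q / 4 * ((S / n) ^+ 2 - r * ln (quad n S / n ^+ 2)) + (N / n - T) ^+ 2 / 2.

Definition cross_lyap (n S N : R) := - ((N / n - T) * ((S / n) ^+ 2 - r)).

Lemma freq_update (n S x : R) : 0 < n ->
  (S + x) / (n + 1) = S / n + (x - S / n) / (n + 1).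
Proof. by move=> n0; field; rewrite !gt_eqF// addr_gt0. Qed.

Lemma ln_div_sqr (x y : R) : 0 < x -> 0 < y -> ln (x / y ^+ 2) = ln x - 2 * ln y.
Proof.
move=> x0 y0; rewrite ln_div ?posrE//; last exact: exprn_gt0.
by rewrite expr2 lnM ?posrE//; ring.
Qed.

Lemma inv_succ_bounds (n : R) : 2 <= n ->
  [/\ 0 < (n + 1)^-1, (n + 1)^-1 <= n^-1, n^-1 <= 2 * (n + 1)^-1,
    n^-1 - (n + 1)^-1 <= n^-1 ^+ 2 & (n + 1)^-1 <= 1].
Proof.
move=> n2; have n0 : 0 < n by lra.
have n10 : 0 < n + 1 by lra.
have h0 : 0 < (n + 1)^-1 by rewrite invr_gt0.
have hi : (n + 1)^-1 <= n^-1 by rewrite lef_pV2 ?posrE//; lra.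
split => //.
- rewrite ler_pdivlMr// ler_pdivrMl//; lra.
- have -> : n^-1 - (n + 1)^-1 = n^-1 * (n + 1)^-1 by field; rewrite !gt_eqF.
  by rewrite expr2 ler_wpM2l// invr_ge0 ltW.
- by rewrite invf_le1//; lra.
Qed.

Lemma log_lyap_step (n S N : R) : 0 < p < 1 -> 3 / 4 <= q -> state_ok n S N ->
  q * (2 - T) = 1 -> T - 3 / 2 * T ^+ 2 + q ^+ 2 / 2 * r = 0 -> 0 <= r ->
  0 <= 3 / 2 * T - 1 -> 0 <= T <= 1 ->
  exists A B C, [/\ log_lyap (n + 1) (S + 1) (N + 1) <= A + B + C,
     log_lyap (n + 1) (S - 1) (N + 1) <= A - B + C, log_lyap (n + 1) S N <= A &
     A + B * drift_pos p n S N + C * move_prob p n S N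
       <= log_lyap n S N - (3 / 2 * T - 1) / 2 * ((N / n - T) ^+ 2 / n)
          + 132 * r * (spread n S N / n) + (2 + 2 * r) * n ^- 2].
Proof.
move=> p01 q34 Sok qT rT r0 c0 T01; have [n2 N2 Nn SN] := Sok; have n0 : 0 < n by lra.
have [Q0 h1 h2 h3] := quad_bounds S n2; have [E1 E2 E3] := quadS n S.
have [y0 ny Sy _] := quad_inv_bounds S n2.
have [t0 t1 st s0 s1] := state_freq Sok.
have [P0 P1] := move_prob_bounds p01 Sok.
have [hh0 hi ih ihh hle1] := inv_succ_bounds n2.
have q1 : q <= 1 by case/andP: p01 => _; rewrite /q; lra.
have q0 : 0 <= q by clear -p T r q34; lra.
have q40 : 0 <= q / 4 by clear -p T r q0; lra.
set s := S / n in s0 s1 st *; set t := N / n in t0 t1 st *.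
set h := (n + 1)^-1 in hh0 hi ih ihh hle1.
set i := n^-1 in hi ih ihh.
set y := (quad n S)^-1 in y0 ny Sy.
have n10 : 0 < n + 1 by lra.
have h20 : 0 <= h ^+ 2 by exact: sqr_ge0.
have y20 : 0 <= y ^+ 2 by exact: sqr_ge0.
have lnn : ln (n + 1) <= ln n + i.
  have -> : n + 1 = n * (1 + i) by rewrite /i; field; rewrite gt_eqF.
  have i0 : 0 < i by exact: lt_le_trans hi.
  rewrite lnM ?posrE// ?addr_gt0// lerD2l.
  by apply: le_ln1Dx; apply: lt_trans i0; rewrite oppr_lt0.
have lnQ D : quad n S / 2 <= quad n S + D ->
   - ln ((quad n S + D) / (n + 1) ^+ 2) <=
   - ln (quad n S / n ^+ 2) + 2 * i - D * y + 2 * D ^+ 2 * y ^+ 2.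
  move=> hD; have QD : 0 < quad n S + D by apply: lt_le_trans hD; rewrite divr_gt0.
  rewrite (ln_div_sqr QD n10) (ln_div_sqr Q0 n0).
  have := ln_taylor Q0 hD; rewrite -/y; move: lnn; clear -p T r; lra.
have sqD : 2 * (129 + 2 * S) ^+ 2 <= 4 * 129 ^+ 2 + 16 * S ^+ 2.
  rewrite -subr_ge0 (_ : _ - _ = 2 * (129 - 2 * S) ^+ 2); last by ring.
  by rewrite mulr_ge0// sqr_ge0.
have sqB : 2 * (129 - 2 * S) ^+ 2 <= 4 * 129 ^+ 2 + 16 * S ^+ 2.
  rewrite -subr_ge0 (_ : _ - _ = 2 * (129 + 2 * S) ^+ 2); last by ring.
  by rewrite mulr_ge0// sqr_ge0.
set L := - ln (quad n S / n ^+ 2) in lnQ.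
have r'0 : 0 <= q / 4 * r by exact: mulr_ge0.
have lnQ1 : q / 4 * r * - ln (quad (n + 1) (S + 1) / (n + 1) ^+ 2) <=
    q / 4 * r * (L + 2 * i - (129 + 2 * S) * y + (4 * 129 ^+ 2 + 16 * S ^+ 2) * y ^+ 2).
  rewrite E1 ler_wpM2l//; apply: (le_trans (lnQ _ h1)).
  by rewrite lerD2l ler_wpM2r.
have lnQ2 : q / 4 * r * - ln (quad (n + 1) (S - 1) / (n + 1) ^+ 2) <=
    q / 4 * r * (L + 2 * i - (129 - 2 * S) * y + (4 * 129 ^+ 2 + 16 * S ^+ 2) * y ^+ 2).
  rewrite E2 ler_wpM2l//; apply: (le_trans (lnQ _ h2)).
  by rewrite lerD2l ler_wpM2r.
have lnQ3 : q / 4 * r * - ln (quad (n + 1) S / (n + 1) ^+ 2) <=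
    q / 4 * r * (L + 2 * i - 128 * y + (4 * 129 ^+ 2) * y ^+ 2).
  rewrite E3 ler_wpM2l//; apply: (le_trans (lnQ _ h3)).
  by rewrite lerD2l ler_wpM2r//; clear -p T r; lra.
have sq4 (x : R) : -2 <= x -> x <= 2 -> q / 4 * (x ^+ 2 * h ^+ 2) <= q / 4 * (4 * h ^+ 2).
  move=> x0 x1; rewrite ler_wpM2l// ler_wpM2r//.
  have : 0 <= (2 - x) * (2 + x) by apply: mulr_ge0; clear -p T r x0 x1; lra.
  by clear -p T r; lra.
have sq1 (x : R) : -1 <= x -> x <= 1 -> x ^+ 2 * h ^+ 2 <= 1 * h ^+ 2.
  move=> x0 x1; rewrite ler_wpM2r//.
  have : 0 <= (1 - x) * (1 + x) by apply: mulr_ge0; clear -p T r x0 x1; lra.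
  by clear -p T r; lra.
(* A step x moves s by (x - s) h and t by (x^2 - t) h. The squares of these moves are absorbed by 4
   h^2 and h^2; the rest is sorted by 1, x, x^2. *)
pose A := q / 4 * (s ^+ 2 - 2 * s ^+ 2 * h + 4 * h ^+ 2)
  + q / 4 * r * (L + 2 * i - 128 * y + (4 * 129 ^+ 2) * y ^+ 2)
  + (t - T) ^+ 2 / 2 - (t - T) * t * h + h ^+ 2.
pose B := q / 4 * (2 * s * h) - q / 4 * r * (2 * S * y).
pose C := q / 4 * r * (- y + 16 * S ^+ 2 * y ^+ 2) + (t - T) * h.
exists A, B, C; split.
- rewrite /log_lyap (freq_update S 1 n0) (freq_update N 1 n0) -/s -/t -/h /A /B /C; move: lnQ1.
  have := sq4 (1 - s); have := sq1 (1 - t).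
  move=> /(_ ltac:(clear -p T r t0 t1; lra) ltac:(clear -p T r t0 t1; lra)) a1.
  move=> /(_ ltac:(clear -p T r s0 s1; lra) ltac:(clear -p T r s0 s1; lra)) a2.
  by move: a1 a2 h20; clear -p T r; lra.
- rewrite /log_lyap (freq_update S (-1) n0) (freq_update N 1 n0) -/s -/t -/h /A /B /C; move: lnQ2.
  have := sq4 (-1 - s); have := sq1 (1 - t).
  move=> /(_ ltac:(clear -p T r t0 t1; lra) ltac:(clear -p T r t0 t1; lra)) a1.
  move=> /(_ ltac:(clear -p T r s0 s1; lra) ltac:(clear -p T r s0 s1; lra)) a2.
  by move: a1 a2 h20; clear -p T r; lra.
- rewrite /log_lyap -[X in (X / (n + 1)) ^+ 2 - _]addr0 -[X in X / (n + 1) - T]addr0 (freq_update S 0 n0) (freq_update N 0 n0).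
  rewrite -/s -/t -/h /A; move: lnQ3.
  have := sq4 (0 - s); have := sq1 (0 - t).
  move=> /(_ ltac:(clear -p T r t0 t1; lra) ltac:(clear -p T r t0 t1; lra)) a1.
  move=> /(_ ltac:(clear -p T r s0 s1; lra) ltac:(clear -p T r s0 s1; lra)) a2.
  by move: a1 a2 h20; clear -p T r; lra.
have z0 : 0 <= n * y by rewrite mulr_ge0// ltW.
have EP : move_prob p n S N = 2 * t - 3 / 2 * t ^+ 2 + q ^+ 2 / 2 * s ^+ 2 by [].
have := log_lyap_algebra q0 q1 r0 qT rT EP erefl t0 t1 P0 P1 hh0 hi ih ihh z0 ny c0.
have -> : A + B * drift_pos p n S N + C * move_prob p n S N = log_lyap n S N
  + (q / 4 * (- 2 * s ^+ 2 * h + 4 * h ^+ 2 + 2 * (q * (2 - t)) * s ^+ 2 * h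
    + r * (2 * i - 128 * (n * y * i) + 4 * 129 ^+ 2 * (n * y * i) ^+ 2
       - 2 * (q * (2 - t)) * ((1 - 128 * (n * y)) * i) - move_prob p n S N * (n * y * i)
       + 16 * move_prob p n S N * ((1 - 128 * (n * y)) * (n * y * i))))
  + (t - T) * h * (move_prob p n S N - t) + h ^+ 2).
  rewrite -Sy (_ : n * y * i = y); last by rewrite /i; field; rewrite gt_eqF.
  rewrite /A /B /C /drift_pos /log_lyap /L -/s -/t -/q.
  set P' := move_prob p n S N; set l := ln _.
  have -> : S = n * s by rewrite /s; field; rewrite gt_eqF.
  have ni : n * i = 1 by rewrite mulfV// gt_eqF.
  have e1 : (n * s) ^+ 2 * y * i = n * s ^+ 2 * y by rewrite /i; field; rewrite gt_eqF.
  by rewrite e1; field.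
have -> : spread n S N / n = n * y * i by [].
rewrite -!/i -/t -exprVn -/i; clear -p T r; lra.
Qed.

End LogLyapunov.

(** Expanding in h, the terms beyond first order have coefficients bounded by |tau b^2| <= 4, 2 |a s
    b| <= 4 and |a b^2 h| <= 4, whence 12. *)
Lemma cross_remainder (R : realType) (tau rho s a b h : R) :
  `|tau| <= 1 -> `|a| <= 1 -> `|b| <= 2 -> `|s| <= 1 -> 0 <= h -> h <= 1 ->
  - ((tau + a * h) * (rho + 2 * s * b * h + b ^+ 2 * h ^+ 2)) <=
  - (tau * rho) - rho * a * h - 2 * tau * s * b * h + 12 * h ^+ 2.
Proof.
move=> t1 a1 b2 s1 h0 h1.
have b4 : `|b ^+ 2| <= 4.
  have : `|b| * `|b| <= 2 * 2 by exact: ler_pM.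
  by rewrite expr2 normrM; lra.
have e1 : `|tau * b ^+ 2| <= 1 * 4 by rewrite normrM; exact: ler_pM.
have e2 : `|a * s * b| <= 1 * 1 * 2.
  rewrite !normrM; apply: ler_pM; [exact: mulr_ge0|exact: normr_ge0| |exact: b2].
  exact: ler_pM.
have e3 : `|a * b ^+ 2 * h| <= 1 * 4 * 1.
  rewrite normrM (normrM a); apply: ler_pM; [exact: mulr_ge0|exact: normr_ge0| |].
    exact: ler_pM.
  by rewrite ger0_norm.
have -> : - ((tau + a * h) * (rho + 2 * s * b * h + b ^+ 2 * h ^+ 2)) =
  - (tau * rho) - rho * a * h - 2 * tau * s * b * h
  + (- (tau * b ^+ 2) - 2 * (a * s * b) - a * b ^+ 2 * h) * h ^+ 2 by ring.
rewrite lerD2l ler_wpM2r ?sqr_ge0//.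
move: e1 e2 e3; rewrite !ler_norml => /andP[? ?] /andP[? ?] /andP[? ?].
lra.
Qed.

(** Along the flow -(t - T)(s^2 - r) has derivative -(q^2 / 2)(s^2 - r)^2 plus terms with a factor t
    - T. As q^2 >= 9/16, part of the negative square absorbs the mixed term and 1/8 of it remains; i
    <= 2 h turns 1/8 into 1/16. *)
Lemma cross_algebra (R : realType) (q T r s t h i P1 m : R) : 3 / 4 <= q -> q <= 1 ->
  q * (2 - T) = 1 -> T - 3 / 2 * T ^+ 2 + q ^+ 2 / 2 * r = 0 ->
  P1 = 2 * t - 3 / 2 * t ^+ 2 + q ^+ 2 / 2 * s ^+ 2 -> m = q * (2 - t) ->
  0 <= t -> t <= 1 -> 0 <= T -> T <= 1 -> s ^+ 2 <= 1 ->
  0 < h -> h <= i -> i <= 2 * h ->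
  - (s ^+ 2 - r) * (P1 - t) * h - 2 * (t - T) * s ^+ 2 * (m - 1) * h + 12 * h ^+ 2 <=
  - 16^-1 * ((s ^+ 2 - r) ^+ 2 * i) + 20 * ((t - T) ^+ 2 * i) + 12 * i ^+ 2.
Proof.
move=> q34 q1 qT rT EP Em t0 t1 T0 T1 s1 h0 hi ih.
have h2 : h ^+ 2 <= i ^+ 2.
  by rewrite lerXn2r// nnegrE ltW//; exact: lt_le_trans hi.
have Em1 : m - 1 = - q * (t - T) by rewrite Em -[X in _ - X]qT; ring.
have EPt : P1 - t = (t - T) * (1 - 3 / 2 * (t + T)) + q ^+ 2 / 2 * (s ^+ 2 - r).
  have -> : P1 - t = P1 - t - (T - 3 / 2 * T ^+ 2 + q ^+ 2 / 2 * r) by rewrite rT subr0.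
  by rewrite EP; field.
rewrite {}Em1 {}EPt; set tau := t - T; set rho := s ^+ 2 - r.
set k := 1 - 3 / 2 * (t + T).
have k2 : k ^+ 2 <= 4.
  have : 0 <= (2 - k) * (2 + k) by apply: mulr_ge0; rewrite /k; clear -t0 t1 T0 T1; lra.
  by clear; lra.
have q2 : 9 / 16 <= q ^+ 2.
  have : 3 / 4 * (3 / 4) <= q * q by apply: ler_pM => //.
  by rewrite expr2; clear; lra.
have tau2 : 0 <= tau ^+ 2 by exact: sqr_ge0.
have rho2 : 0 <= rho ^+ 2 by exact: sqr_ge0.
(* AM-GM: [- rho tau k <= rho^2 / 8 + 2 k^2 tau^2] *)
have f1 : - (rho * (tau * k)) <= rho ^+ 2 / 8 + 2 * (k ^+ 2 * tau ^+ 2).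
  have := sqr_ge0 (rho / 4 + tau * k); clear; lra.
have f2 : k ^+ 2 * tau ^+ 2 <= 4 * tau ^+ 2 by rewrite ler_wpM2r.
have f3 : 9 / 16 * rho ^+ 2 <= q ^+ 2 * rho ^+ 2 by rewrite ler_wpM2r.
have f4 : q * s ^+ 2 * tau ^+ 2 <= 1 * tau ^+ 2.
  rewrite ler_wpM2r//; have : q * s ^+ 2 <= 1 * 1.
    by apply: ler_pM => //; [clear -q34; lra|exact: sqr_ge0].
  by clear; lra.
have f5 : - rho * (tau * k + q ^+ 2 / 2 * rho) - 2 * tau * s ^+ 2 * (- q * tau)
   <= - 8^-1 * rho ^+ 2 + 20 * tau ^+ 2.
  by move: f1 f2 f3 f4 tau2 rho2; clear; lra.
have f6 := ler_wpM2r (ltW h0) f5.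
have f7 : rho ^+ 2 * i <= rho ^+ 2 * (2 * h) by rewrite ler_wpM2l.
have f8 : tau ^+ 2 * h <= tau ^+ 2 * i by rewrite ler_wpM2l.
by move: f6 f7 f8 h2; clear; lra.
Qed.

Lemma cross_lyap_step (R : realType) (p T r n S N : R) : let q := 2 * p - 1 in
  0 < p < 1 -> 3 / 4 <= q -> state_ok n S N ->
  q * (2 - T) = 1 -> T - 3 / 2 * T ^+ 2 + q ^+ 2 / 2 * r = 0 -> 0 <= T <= 1 ->
  exists A B C, [/\ cross_lyap T r (n + 1) (S + 1) (N + 1) <= A + B + C,
     cross_lyap T r (n + 1) (S - 1) (N + 1) <= A - B + C,
     cross_lyap T r (n + 1) S N <= A &
     A + B * drift_pos p n S N + C * move_prob p n S N
       <= cross_lyap T r n S N - 16^-1 * (((S / n) ^+ 2 - r) ^+ 2 / n)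
          + 20 * ((N / n - T) ^+ 2 / n) + 12 * n ^- 2].
Proof.
move=> q p01 q34 Sok qT rT /andP[T0 T1]; have [n2 N2 Nn SN] := Sok.
have n0 : 0 < n by lra.
have [t0 t1 st s0 s1] := state_freq Sok.
have [hh0 hi ih ihh hle1] := inv_succ_bounds n2.
have q1 : q <= 1 by case/andP: p01 => _; rewrite /q; lra.
set s := S / n in s0 s1 st *; set t := N / n in t0 t1 st *.
set h := (n + 1)^-1 in hh0 hi ih ihh hle1.
set i := n^-1 in hi ih ihh.
pose tau := t - T; pose rho := s ^+ 2 - r.
have h0 := ltW hh0.
have ntau : `|tau| <= 1 by rewrite ler_norml /tau; clear -t0 t1 T0 T1; lra.
have ns : `|s| <= 1 by rewrite ler_norml; apply/andP; split.
exists (- (tau * rho) + rho * t * h + 2 * tau * s ^+ 2 * h + 12 * h ^+ 2),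
  (- 2 * tau * s * h), (- rho * h).
split.
- rewrite /cross_lyap (freq_update S 1 n0) (freq_update N 1 n0) -/s -/t -/h.
  have := @cross_remainder _ tau rho s (1 - t) (1 - s) h ntau.
  move=> /(_ ltac:(rewrite ler_norml; clear -t0 t1; lra)).
  move=> /(_ ltac:(rewrite ler_norml; clear -s0 s1; lra) ns h0 hle1).
  by rewrite /tau /rho; clear; lra.
- rewrite /cross_lyap (freq_update S (-1) n0) (freq_update N 1 n0) -/s -/t -/h.
  have := @cross_remainder _ tau rho s (1 - t) (-1 - s) h ntau.
  move=> /(_ ltac:(rewrite ler_norml; clear -t0 t1; lra)).
  move=> /(_ ltac:(rewrite ler_norml; clear -s0 s1; lra) ns h0 hle1).
  by rewrite /tau /rho; clear; lra.
- rewrite /cross_lyap -[X in (X / (n + 1)) ^+ 2 - _]addr0 -[X in X / (n + 1) - T]addr0.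
  rewrite (freq_update S 0 n0) (freq_update N 0 n0) -/s -/t -/h.
  have := @cross_remainder _ tau rho s (0 - t) (0 - s) h ntau.
  move=> /(_ ltac:(rewrite ler_norml; clear -t0 t1; lra)).
  move=> /(_ ltac:(rewrite ler_norml; clear -s0 s1; lra) ns h0 hle1).
  by rewrite /tau /rho; clear; lra.
have EP : move_prob p n S N = 2 * t - 3 / 2 * t ^+ 2 + q ^+ 2 / 2 * s ^+ 2 by [].
have s2 : s ^+ 2 <= 1 by apply: le_trans st _; rewrite expr_le1.
have := cross_algebra q34 q1 qT rT EP erefl t0 t1 T0 T1 s2 hh0 hi ih.
rewrite /cross_lyap -/s -/t -exprVn -/i /drift_pos -/s -/t -/q.
by rewrite /tau /rho; clear; lra.
Qed.

(** * The quadratic Lyapunov function below the critical value *)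

Definition center_lyap (R : realType) (al n S N : R) :=
  al * (S / n) ^+ 2 + (N / n - 2 / 3) ^+ 2 / 2.

(** For q > 0 the weight al = q / 4 makes t drop out of the coefficient of s^2, which becomes -(q /
    2)(1 - 4 q / 3). For q <= 0 the position part is at most -2 s^2 with al = 1 and beats the mixed
    term, at most s^2 / 6. The remaining -(3/2) t (t - 2/3)^2 degenerates as t tends to 0, where [e]
    takes over. *)
Lemma center_algebra (R : realType) (q : R) : q < 3 / 4 -> -1 <= q ->
  exists al c, [/\ 0 <= al, 0 < c &
  forall s t e P1 : R,
  P1 = 2 * t - 3 / 2 * t ^+ 2 + q ^+ 2 / 2 * s ^+ 2 ->
  0 <= t -> t <= 1 -> 0 <= e -> (t <= 1 / 3 -> 1 / 3 <= e) ->
  2 * al * s ^+ 2 * (q * (2 - t) - 1) + (t - 2 / 3) * (P1 - t)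
   <= - c * (s ^+ 2 + (t - 2 / 3) ^+ 2) + e].
Proof.
move=> q34 qm1.
have tau_le (t e : R) : 0 <= t -> t <= 1 -> 0 <= e -> (t <= 1 / 3 -> 1 / 3 <= e) ->
   1 / 2 * (t - 2 / 3) ^+ 2 - e <= 3 / 2 * t * (t - 2 / 3) ^+ 2.
  move=> t0 t1 e0 he; have [h|h] := leP t (1 / 3).
    have := he h; have : 0 <= t * (t - 2 / 3) ^+ 2 by rewrite mulr_ge0 ?sqr_ge0.
    have : (t - 2 / 3) ^+ 2 <= 4 / 9.
      have : 0 <= t * (4 / 3 - t) by rewrite mulr_ge0//; clear -h; lra.
      by clear; lra.
    by clear; lra.
  have : 1 / 3 * (t - 2 / 3) ^+ 2 <= t * (t - 2 / 3) ^+ 2.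
    by rewrite ler_wpM2r ?sqr_ge0// ltW.
  by move: e0; clear; lra.
have [q0|q0] := leP q 0.
  exists 1, (1 / 2); split; [by []|by rewrite divr_gt0|].
  move=> s t e P1 -> t0 t1 e0 he; have := tau_le t e t0 t1 e0 he.
  have s2 : 0 <= s ^+ 2 by exact: sqr_ge0.
  have : q * (2 - t) * s ^+ 2 <= 0.
    by rewrite mulr_le0_ge0// mulr_le0_ge0//; clear -t1; lra.
  have : q ^+ 2 / 2 * (t - 2 / 3) * s ^+ 2 <= 1 / 6 * s ^+ 2.
    rewrite ler_wpM2r//.
    have q2 : q ^+ 2 <= 1.
      have : 0 <= (1 - q) * (1 + q) by apply: mulr_ge0; clear -q0 qm1; lra.
      by clear; lra.
    have [h|h] := leP (t - 2 / 3) 0.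
      apply: (@le_trans _ _ 0) => //; rewrite mulr_ge0_le0//.
      by rewrite divr_ge0// sqr_ge0.
    have : q ^+ 2 / 2 * (t - 2 / 3) <= 1 / 2 * (1 / 3).
      apply: ler_pM; [by rewrite divr_ge0// sqr_ge0|exact: ltW|clear -q2; lra|].
      by clear -t1; lra.
    by clear; lra.
  by move: s2; clear; lra.
exists (q / 4), (Num.min (1 / 2) (q / 2 * (1 - 4 / 3 * q))); split.
- by rewrite divr_ge0// ltW.
- by rewrite lt_min divr_gt0//= mulr_gt0// ?divr_gt0//; clear -q34; lra.
move=> s t e P1 -> t0 t1 e0 he; have := tau_le t e t0 t1 e0 he.
set c := Num.min _ _.
have c1 : c <= 1 / 2 by rewrite ge_min lexx.
have c2 : c <= q / 2 * (1 - 4 / 3 * q) by rewrite ge_min lexx orbT.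
have := ler_wpM2r (sqr_ge0 s) c2.
have := ler_wpM2r (sqr_ge0 (t - 2 / 3)) c1.
by clear; lra.
Qed.

Lemma center_lyap_step (R : realType) (p : R) : 0 < p < 1 -> p < 7 / 8 ->
  exists al c : R, [/\ 0 <= al, 0 < c & forall n S N, state_ok n S N ->
  exists A B C, [/\ center_lyap al (n + 1) (S + 1) (N + 1) <= A + B + C,
     center_lyap al (n + 1) (S - 1) (N + 1) <= A - B + C,
     center_lyap al (n + 1) S N <= A &
     A + B * drift_pos p n S N + C * move_prob p n S N
       <= center_lyap al n S N - c * (((S / n) ^+ 2 + (N / n - 2 / 3) ^+ 2) / n)
          + escape n S N / n + (4 * al + 1) * n ^- 2]].
Proof.
move=> p01 p78; set q := 2 * p - 1.
have [q34 qm1] : q < 3 / 4 /\ -1 <= q.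
  by case/andP: p01 => p0 _; rewrite /q; split; clear -p0 p78; lra.
have [al [c [al0 c0 hal]]] := center_algebra q34 qm1.
(* Halving [c] pays for replacing 1 / (n + 1) by 1 / n. *)
exists al, (c / 2); split; [by []|by rewrite divr_gt0|].
move=> n S N Sok; have [n2 N2 Nn SN] := Sok.
have n0 : 0 < n by clear -n2; lra.
have [t0 t1 st s0 s1] := state_freq Sok.
have [hh0 hi ih ihh hle1] := inv_succ_bounds n2.
have e0 := escape_ge0 S (ltW n0) N2.
have he := escape_ge_third Sok.
set s := S / n in s0 s1 st *; set t := N / n in t0 t1 st he *.
set e := escape n S N in e0 he *.
set h := (n + 1)^-1 in hh0 hi ih ihh hle1.
set i := n^-1 in hi ih ihh.
have h20 : 0 <= h ^+ 2 by exact: sqr_ge0.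
have sq4 (x : R) : -2 <= x -> x <= 2 -> al * (x ^+ 2 * h ^+ 2) <= al * (4 * h ^+ 2).
  move=> x0 x1; rewrite ler_wpM2l// ler_wpM2r//.
  have : 0 <= (2 - x) * (2 + x) by apply: mulr_ge0; clear -x0 x1; lra.
  by clear; lra.
have sq1 (x : R) : -1 <= x -> x <= 1 -> x ^+ 2 * h ^+ 2 <= 1 * h ^+ 2.
  move=> x0 x1; rewrite ler_wpM2r//.
  have : 0 <= (1 - x) * (1 + x) by apply: mulr_ge0; clear -x0 x1; lra.
  by clear; lra.
exists (al * (s ^+ 2 - 2 * s ^+ 2 * h + 4 * h ^+ 2) + (t - 2 / 3) ^+ 2 / 2
  - (t - 2 / 3) * t * h + h ^+ 2), (al * (2 * s * h)), ((t - 2 / 3) * h); split.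
- rewrite /center_lyap (freq_update S 1 n0) (freq_update N 1 n0) -/s -/t -/h.
  have := sq4 (1 - s); have := sq1 (1 - t).
  move=> /(_ ltac:(clear -t0 t1; lra) ltac:(clear -t0 t1; lra)) a1.
  move=> /(_ ltac:(clear -s0 s1; lra) ltac:(clear -s0 s1; lra)) a2.
  by move: a1 a2 h20; clear; lra.
- rewrite /center_lyap (freq_update S (-1) n0) (freq_update N 1 n0) -/s -/t -/h.
  have := sq4 (-1 - s); have := sq1 (1 - t).
  move=> /(_ ltac:(clear -t0 t1; lra) ltac:(clear -t0 t1; lra)) a1.
  move=> /(_ ltac:(clear -s0 s1; lra) ltac:(clear -s0 s1; lra)) a2.
  by move: a1 a2 h20; clear; lra.
- rewrite /center_lyap -[X in al * (X / _) ^+ 2]addr0 -[X in X / (n + 1) - 2 / 3]addr0.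
  rewrite (freq_update S 0 n0) (freq_update N 0 n0) -/s -/t -/h.
  have := sq4 (0 - s); have := sq1 (0 - t).
  move=> /(_ ltac:(clear -t0 t1; lra) ltac:(clear -t0 t1; lra)) a1.
  move=> /(_ ltac:(clear -s0 s1; lra) ltac:(clear -s0 s1; lra)) a2.
  by move: a1 a2 h20; clear; lra.
have EP : move_prob p n S N = 2 * t - 3 / 2 * t ^+ 2 + q ^+ 2 / 2 * s ^+ 2 by [].
have f1 := ler_wpM2r (ltW hh0) (hal s t e _ EP t0 t1 e0 he).
have h2 : (4 * al + 1) * h ^+ 2 <= (4 * al + 1) * i ^+ 2.
  rewrite ler_wpM2l//; first by clear -al0; lra.
  by rewrite lerXn2r// nnegrE ltW//; exact: lt_le_trans hi.
have f2 : c * (s ^+ 2 + (t - 2 / 3) ^+ 2) * i <= c * (s ^+ 2 + (t - 2 / 3) ^+ 2) * (2 * h).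
  by rewrite ler_wpM2l// mulr_ge0 ?(ltW c0)// addr_ge0 ?sqr_ge0.
have f3 : e * h <= e * i by rewrite ler_wpM2l.
rewrite /center_lyap -/s -/t -/e -exprVn -/i /drift_pos -/s -/t -/q.
by move: f1 f2 f3 h2; clear; lra.
Qed.

(** * Summability of the mean deviations *)

Section Summability.
Context {R : realType} (p : R).
Hypothesis p01 : 0 < p < 1.
Let q : R := 2 * p - 1.

Definition mean_at (f : R -> R -> R -> R) (m : nat) : R := law p m (on_state f).

Lemma mean_at_le f g m : (forall n S N, n = m.+2%:R -> state_ok n S N ->
  f n S N <= g n S N) -> mean_at f m <= mean_at g m.
Proof.
move=> fg; apply: law_le => // l lok; have [sl N2 Nn SN] := @path_ok_state R _ _ lok.
by apply: fg => //; split=> //; rewrite sl// ler_nat.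
Qed.

Lemma mean_atD f g m :
  mean_at (fun n S N => f n S N + g n S N) m = mean_at f m + mean_at g m.
Proof. exact: lawD. Qed.

Lemma mean_atZ x f m : mean_at (fun n S N => x * f n S N) m = x * mean_at f m.
Proof. exact: lawZ. Qed.

Lemma mean_at_cst x m : mean_at (fun _ _ _ => x) m = x.
Proof. exact: law_cst. Qed.

Lemma bsum_mean_le f g : (forall n S N, state_ok n S N -> f n S N <= g n S N) ->
  bsum (mean_at g) -> bsum (mean_at f).
Proof.
by move=> fg; apply: (bsum_near_le (n0 := 0)) => m _; apply: mean_at_le => n S N _; exact: fg.
Qed.

Lemma bsum_meanD f g : bsum (mean_at f) -> bsum (mean_at g) ->
  bsum (mean_at (fun n S N => f n S N + g n S N)).
Proof. by move=> hf hg; apply: (bsum_near_le (n0 := 0)) (bsumD hf hg) => m _; rewrite mean_atD. Qed.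

Lemma bsum_meanZ x f : 0 <= x -> bsum (mean_at f) ->
  bsum (mean_at (fun n S N => x * f n S N)).
Proof. by move=> x0 hf; apply: (bsum_near_le (n0 := 0)) (bsumZ x0 hf) => m _; rewrite mean_atZ. Qed.

Lemma bsum_mean_inv_sqr x : bsum (mean_at (fun n _ _ => x * n ^- 2)).
Proof.
apply: (bsum_near_le (n0 := 0)) (bsum_cst_inv_sqr x) => m _.
by rewrite -[leRHS](mean_at_cst _ m); apply: mean_at_le => n S N ->.
Qed.

(** Every Lyapunov function is used through this statement. The threshold [n0] accommodates
    [escape], whose one-step bound is available from n = 40 on. *)
Lemma bsum_mean_drift (f b c : R -> R -> R -> R) (n0 : nat) (a : R) :
  (forall n S N, n0%:R <= n -> state_ok n S N ->
    exists A B C, [/\ f (n + 1) (S + 1) (N + 1) <= A + B + C,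
      f (n + 1) (S - 1) (N + 1) <= A - B + C, f (n + 1) S N <= A &
      A + B * drift_pos p n S N + C * move_prob p n S N
        <= f n S N - b n S N + c n S N]) ->
  (forall n S N, state_ok n S N -> a <= f n S N) ->
  bsum (mean_at c) -> bsum (mean_at b).
Proof.
move=> hstep ha hc; apply: (@bsum_telescope _ (mean_at f) _ _ n0 a) hc => m.
  move=> n0m; have -> : mean_at f m - mean_at b m + mean_at c m =
      mean_at (fun n S N => f n S N - b n S N + c n S N) m.
    rewrite mean_atD; congr (_ + _); rewrite -mulN1r -mean_atZ -mean_atD.
    by apply: eq_law => // l _; rewrite /on_state mulN1r.
  apply: law_step => // n S N nE N2 Nn SN; apply: hstep; last first.
    by split=> //; rewrite nE ler_nat.
  by rewrite nE ler_nat (leq_trans n0m)// -addn2 leq_addr.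
rewrite -(mean_at_cst a m); apply: mean_at_le => n S N _; exact: ha.
Qed.

Lemma bsum_escape : bsum (mean_at (fun n S N => escape n S N / n)).
Proof.
have h : bsum (mean_at (fun n S N => 20^-1 * (escape n S N / n))).
  apply: (@bsum_mean_drift escape _ (fun n _ _ => 4 * n ^- 2) 40 0).
  - by move=> n S N n40 [_ N2 _ _]; exact: escape_step.
  - by move=> n S N [n2 N2 _ _]; apply: escape_ge0 => //; lra.
  - exact: bsum_mean_inv_sqr.
have h20 : 0 < 20 :> R by rewrite ltr0n.
apply: bsum_mean_le (bsum_meanZ (ltW h20) h) => n S N _.
by rewrite mulrA mulfV ?gt_eqF// mul1r.
Qed.

Lemma center_summable : p < 7 / 8 ->
  bsum (mean_at (fun n S N => ((N / n - 2 / 3) ^+ 2 + ((S / n) ^+ 2 - 0) ^+ 2) / n)).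
Proof.
move=> p78; have [al [c [al0 c0 hstep]]] := center_lyap_step p01 p78.
have h : bsum (mean_at (fun n S N =>
    c * (((S / n) ^+ 2 + (N / n - 2 / 3) ^+ 2) / n))).
  apply: (@bsum_mean_drift (center_lyap al) _
    (fun n S N => escape n S N / n + (4 * al + 1) * n ^- 2) 0 0).
  - move=> n S N _ Sok; have [A [B [C [? ? ? h]]]] := hstep n S N Sok.
    by exists A, B, C; split => //; rewrite addrA.
  - move=> n S N _; apply: addr_ge0; [apply: mulr_ge0|apply: divr_ge0] => //; exact: sqr_ge0.
  - exact: bsum_meanD bsum_escape (bsum_mean_inv_sqr _).
have ci : 0 <= c^-1 by rewrite invr_ge0 ltW.
apply: bsum_mean_le (bsum_meanZ ci h) => n S N Sok.
have [_ t1 s2 _ _] := state_freq Sok.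
have n0 : 0 <= n^-1 by rewrite invr_ge0; case: Sok; lra.
rewrite mulKf ?gt_eqF// ler_wpM2r//.
have s1 : (S / n) ^+ 2 <= 1 by apply: le_trans s2 _; rewrite expr_le1//; case: (state_freq Sok).
by rewrite subr0 addrC lerD2r expr2 ler_piMl// sqr_ge0.
Qed.

Lemma bsum_spread : 3 / 4 <= q -> bsum (mean_at (fun n S N => spread n S N / n)).
Proof.
move=> q34; have h : bsum (mean_at (fun n S N => 256^-1 * (spread n S N / n))).
  apply: (@bsum_mean_drift spread _
    (fun n S N => escape n S N / n + 1 * n ^- 2) 0 0).
  - move=> n S N _ Sok; have [A [B [C [? ? ? h]]]] := spread_step p01 q34 Sok.
    by exists A, B, C; split => //; rewrite mul1r addrA.
  - move=> n S N [n2 _ _ _]; have [y0 _ _ _] := quad_inv_bounds S n2.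
    by rewrite mulr_ge0 ?ltW//; lra.
  - exact: bsum_meanD bsum_escape (bsum_mean_inv_sqr _).
have h0 : 0 < 256 :> R by rewrite ltr0n.
apply: bsum_mean_le (bsum_meanZ (ltW h0) h) => n S N _.
by rewrite mulrA mulfV ?gt_eqF// mul1r.
Qed.

Lemma pair_summable (T r : R) : 3 / 4 <= q -> q * (2 - T) = 1 ->
  T - 3 / 2 * T ^+ 2 + q ^+ 2 / 2 * r = 0 -> 0 <= r -> 2 / 3 < T <= 1 ->
  bsum (mean_at (fun n S N => ((N / n - T) ^+ 2 + ((S / n) ^+ 2 - r) ^+ 2) / n)).
Proof.
move=> q34 qT rT r0 /andP[T23 T1]; have T01 : 0 <= T <= 1 by apply/andP; split; lra.
have c0 : 0 < 3 / 2 * T - 1 by lra.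
have q0 : 0 <= q by lra.
have h1 : bsum (mean_at (fun n S N => (N / n - T) ^+ 2 / n)).
  have h : bsum (mean_at (fun n S N =>
      (3 / 2 * T - 1) / 2 * ((N / n - T) ^+ 2 / n))).
    (* The lower bound uses ln x < x and [quad] / n^2 = s^2 + 128 / n <= 129. *)
    apply: (@bsum_mean_drift (log_lyap p T r) _
      (fun n S N => 132 * r * (spread n S N / n) + (2 + 2 * r) * n ^- 2) 0
      (- (q / 4 * r * 129))).
    - move=> n S N _ Sok.
      have [A [B [C [? ? ? h]]]] := log_lyap_step p01 q34 Sok qT rT r0 (ltW c0) T01.
      by exists A, B, C; split => //; rewrite addrA.
    - move=> n S N Sok; have [n2 N2 Nn SN] := Sok.
      have [t0 t1 s2 _ _] := state_freq Sok.
      have [Q0 _ _ _] := quad_bounds S n2; have n0 : 0 < n by lra.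
      have s1 : (S / n) ^+ 2 <= 1 by apply: le_trans s2 _; rewrite expr_le1.
      have Qn : quad n S / n ^+ 2 <= 129.
        have -> : quad n S / n ^+ 2 = (S / n) ^+ 2 + 128 * n^-1.
          by rewrite /quad; field; rewrite gt_eqF.
        have : n^-1 <= 1 by rewrite invf_le1//; lra.
        by move: s1; clear; lra.
      have L : ln (quad n S / n ^+ 2) <= 129.
        by apply: le_trans (ltW (ln_sublinear _)) Qn; rewrite divr_gt0 ?exprn_gt0.
      have : q / 4 * r * ln (quad n S / n ^+ 2) <= q / 4 * r * 129.
        by rewrite ler_wpM2l// mulr_ge0// divr_ge0.
      have : 0 <= q / 4 * (S / n) ^+ 2 by apply: mulr_ge0; [exact: divr_ge0|exact: sqr_ge0].
      have := sqr_ge0 (N / n - T); rewrite /log_lyap -/q.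
      set x := (N / n - T) ^+ 2; clear; lra.
    - apply: bsum_meanD (bsum_mean_inv_sqr _).
      by apply: bsum_meanZ (bsum_spread q34); rewrite mulr_ge0.
  have ci : 0 <= ((3 / 2 * T - 1) / 2)^-1 by rewrite invr_ge0 divr_ge0// ltW.
  apply: bsum_mean_le (bsum_meanZ ci h) => n S N _.
  by rewrite mulKf// gt_eqF// divr_gt0.
have h2 : bsum (mean_at (fun n S N => 16^-1 * (((S / n) ^+ 2 - r) ^+ 2 / n))).
  apply: (@bsum_mean_drift (cross_lyap T r) _
    (fun n S N => 20 * ((N / n - T) ^+ 2 / n) + 12 * n ^- 2) 0 (- (1 * (1 + r)))).
  - move=> n S N _ Sok.
    have [A [B [C [? ? ? h]]]] := cross_lyap_step p01 q34 Sok qT rT T01.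
    by exists A, B, C; split => //; rewrite addrA.
  - move=> n S N Sok; have [t0 t1 s2 _ _] := state_freq Sok.
    have s1 : (S / n) ^+ 2 <= 1 by apply: le_trans s2 _; rewrite expr_le1.
    have s0 := sqr_ge0 (S / n).
    rewrite /cross_lyap lerN2; apply: le_trans (ler_norm _) _; rewrite normrM.
    by apply: ler_pM => //; rewrite ler_norml; apply/andP; split; lra.
  - by apply: bsum_meanD (bsum_mean_inv_sqr _); exact: bsum_meanZ.
have h0 : 0 < 16 :> R by rewrite ltr0n.
apply: bsum_mean_le (bsum_meanD h1 (bsum_meanZ (ltW h0) h2)) => n S N _.
by rewrite mulrA mulfV ?gt_eqF// mul1r mulrDl.
Qed.

End Summability.

(** * The law of the walk *)

HB.instance Definition _ := gen_eqMixin bidx.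

Section Channels.
Context {R : realType} (p : R).

Definition rad_weight (b : int) : R := if b == 1 then p else 1 - p.

Definition indices (n : nat) : seq int := [seq Posz j.+1 | j <- iota 0 n].

Lemma sum_letters (l : seq int) (psi : int -> R) : all (mem letters) l ->
  \sum_(y <- l) psi y = (count (fun y => y == 1%R) l)%:R * psi 1 +
    (count (fun y => y == (-1)%R) l)%:R * psi (-1) +
    (count (fun y => y == 0%R) l)%:R * psi 0.
Proof.
elim: l => [_|x l IHl /andP[xl /IHl h]]; first by rewrite big_nil /= !mul0r !addr0.
rewrite big_cons h /= !natrD; move: xl; rewrite /= !inE.
by move=> /or3P[] /eqP -> /=; ring.
Qed.

Lemma sum_indices (l : seq int) (psi : int -> R) :
  \sum_(j <- indices (size l)) psi (nth 0 l (absz j).-1) = \sum_(y <- l) psi y.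
Proof. by rewrite big_map [RHS](big_nth 0) /index_iota subn0. Qed.

Lemma channel_mean (l : seq int) (psi : int -> R) : all (mem letters) l ->
  l != [::] ->
  \sum_(b <- [:: 1; -1]) \sum_(j <- indices (size l))
    rad_weight b * (size l)%:R^-1 * psi (b * nth 0 l (absz j).-1) =
  (p * freq 1 l + (1 - p) * freq (-1) l) * psi 1 +
  (p * freq (-1) l + (1 - p) * freq 1 l) * psi (-1) +
  (1 - freq 1 l - freq (-1) l) * psi 0.
Proof.
move=> al l0; have n0 : (size l)%:R != 0 :> R by rewrite pnatr_eq0 size_eq0.
have sb b : \sum_(j <- indices (size l))
    rad_weight b * (size l)%:R^-1 * psi (b * nth 0 l (absz j).-1) =
    rad_weight b * (size l)%:R^-1 * \sum_(y <- l) psi (b * y).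
  by rewrite -mulr_sumr (sum_indices l (fun y => psi (b * y))).
rewrite !big_cons big_nil !sb !(sum_letters _ al) addr0 /rad_weight /= /freq.
rewrite !mul1r !mulN1r opprK oppr0.
have := count_letters al => /(congr1 (fun k => k%:R : R)); rewrite !natrD.
set k1 := (count (fun y => y == 1%R) l)%:R; set k2 := (count (fun y => y == (-1)%R) l)%:R.
set k0 := (count (fun y => y == 0%R) l)%:R; set n := (size l)%:R in n0 *.
by move=> en; rewrite (_ : k0 = n - k1 - k2); [field|rewrite -en; ring].
Qed.

(** Averaging over the second channel with the contribution y of the first held fixed gives a
    function [psi] of y, so the one-channel mean is applied twice. *)
Lemma two_channels (l : seq int) (phi : int -> R) : all (mem letters) l ->
  l != [::] ->
  \sum_(b1 <- [:: 1; -1]) \sum_(j1 <- indices (size l))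
  \sum_(b2 <- [:: 1; -1]) \sum_(j2 <- indices (size l))
    rad_weight b1 * (size l)%:R^-1 * (rad_weight b2 * (size l)%:R^-1) *
    phi (clip (b1 * nth 0 l (absz j1).-1 + b2 * nth 0 l (absz j2).-1)) =
  up_prob p (freq 1 l) (freq (-1) l) * phi 1 +
  up_prob p (freq (-1) l) (freq 1 l) * phi (-1) +
  (1 - up_prob p (freq 1 l) (freq (-1) l) - up_prob p (freq (-1) l) (freq 1 l)) * phi 0.
Proof.
move=> al l0.
pose psi y := \sum_(b2 <- [:: 1; -1]) \sum_(j2 <- indices (size l))
    rad_weight b2 * (size l)%:R^-1 * phi (clip (y + b2 * nth 0 l (absz j2).-1)).
under eq_bigr => b1 _ do under eq_bigr => j1 _ do
  [under eq_bigr => b2 _ do [under eq_bigr => j2 _ do rewrite -mulrA;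
    rewrite -mulr_sumr]; rewrite -mulr_sumr -/(psi (b1 * nth 0 l (absz j1).-1))].
rewrite channel_mean// /psi.
rewrite !(channel_mean (fun c => phi (clip (_ + c))))//.
by rewrite /up_prob /clip; ring.
Qed.

End Channels.

Section WalkLaw.
Context {R : realType} {d : measure_display} {T : measurableType d}
  (P : probability T R) (p : R) (x1 x2 : T -> int) (u1 u2 a1 a2 : nat -> T -> int).
Hypothesis p01 : 0 < p < 1.
Hypothesis model : two_channel_model P p x1 x2 u1 u2 a1 a2.

Let Y := base_var x1 x2 u1 u2 a1 a2.
Let W := walk_at x1 x2 u1 u2 a1 a2.
Let Pr (A : set T) : R := fine (P A).

Lemma prE (A : set T) : measurable A -> P A = (Pr A)%:E.
Proof. by move=> mA; rewrite /Pr fineK// fin_num_measure. Qed.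

Lemma preimage_countable (K : countType) (f : T -> K) :
  (forall k, measurable (f @^-1` [set k])) -> forall B : set K, measurable (f @^-1` B).
Proof.
move=> mf B; have -> : f @^-1` B = \bigcup_k (if k \in B then f @^-1` [set k] else set0).
  apply/seteqP; split=> w /=.
    by move=> Bw; exists (f w) => //; rewrite mem_set.
  by move=> [k _]; case: ifPn => // /set_mem Bk /= ->.
apply: countable_bigcupT_measurable; first exact: countableP.
by move=> k; case: ifP.
Qed.

Lemma base_measurable i v : used_idx i -> measurable (Y i @^-1` [set v]).
Proof. by have [h _ _ _ _] := model; exact: h. Qed.

Lemma walk_measurable m (B : set (seq int)) : measurable (W m.+2 @^-1` B).
Proof.
elim: m B => [|m IHm] B.
  pose f w : int * int := (x1 w, x2 w).
  have -> : W 2 @^-1` B = f @^-1` [set v | B [:: v.1; v.2]] by [].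
  apply: preimage_countable => -[v1 v2].
  have -> : f @^-1` [set (v1, v2)] = Y bX1 @^-1` [set v1] `&` Y bX2 @^-1` [set v2].
    apply/seteqP; split=> w; first by move=> [e1 e2]; split; [exact: e1|exact: e2].
    by move=> [e1 e2]; congr (_, _); [exact: e1|exact: e2].
  by apply: measurableI; exact: base_measurable.
pose f w : seq int * (int * int * int * int) :=
  (W m.+2 w, (a1 m.+3 w, u1 m.+3 w, a2 m.+3 w, u2 m.+3 w)).
have -> : W m.+3 @^-1` B = f @^-1` [set v |
    B (rcons v.1 (clip (v.2.1.1.1 * nth 0 v.1 (absz v.2.1.1.2).-1 +
                        v.2.1.2 * nth 0 v.1 (absz v.2.2).-1)))] by [].
apply: preimage_countable => -[l [[[b1 v1] b2] v2]].
have -> : f @^-1` [set (l, (b1, v1, b2, v2))] = W m.+2 @^-1` [set l] `&`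
    (Y (bA1 m.+3) @^-1` [set b1] `&` (Y (bU1 m.+3) @^-1` [set v1] `&`
    (Y (bA2 m.+3) @^-1` [set b2] `&` Y (bU2 m.+3) @^-1` [set v2]))).
  apply/seteqP; split=> w; first move=> [e1 e2 e3 e4 e5].
    split; [exact: e1|split; [exact: e2|split; [exact: e3|]]].
    by split; [exact: e4|exact: e5].
  move=> [e1 [e2 [e3 [e4 e5]]]].
  by congr (_, (_, _, _, _)); [exact: e1|exact: e2|exact: e3|exact: e4|exact: e5].
by do 4 (apply: measurableI; first by [exact: IHm|exact: base_measurable]);
  exact: base_measurable.
Qed.

Definition cylinder (fs : seq (bidx * int)) : set T :=
  \big[setI/setT]_(c <- fs) (Y c.1 @^-1` [set c.2]).

Definition weight (fs : seq (bidx * int)) : R :=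
  \prod_(c <- fs) Pr (Y c.1 @^-1` [set c.2]).

Lemma cylinder_prob fs : uniq (map fst fs) -> all used_idx (map fst fs) ->
  Pr (cylinder fs) = weight fs.
Proof.
move=> ufs afs; have [_ ind _ _ _] := model.
pose f j := (tnth (in_tuple fs) j).1; pose v j := (tnth (in_tuple fs) j).2.
have finj : injective f.
  move=> i j; rewrite /f !(tnth_nth (bX1, 0)) => eij; apply/val_inj/eqP.
  have sz (k : 'I_(size fs)) : (k < size (map fst fs))%N by rewrite size_map.
  by rewrite -(nth_uniq bX1 (sz i) (sz j) ufs) !(nth_map (bX1, 0))//; apply/eqP.
have fused j : used_idx (f j).
  by move: afs; rewrite all_map => /allP; apply; rewrite mem_tnth.
rewrite /cylinder /weight [X in Pr X]big_tnth [RHS]big_tnth [LHS]/Pr.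
rewrite (ind _ f finj fused v).
rewrite (eq_bigr (fun j => (Pr (Y (f j) @^-1` [set v j]))%:E)).
  by rewrite prodEFin.
by move=> j _; rewrite prE//; exact: base_measurable.
Qed.

Lemma cylinder_measurable fs : all used_idx (map fst fs) -> measurable (cylinder fs).
Proof.
elim: fs => [|c fs IHfs] /=; first by rewrite /cylinder big_nil.
move=> /andP[uc /IHfs h]; rewrite /cylinder big_cons.
by apply: measurableI => //; exact: base_measurable.
Qed.

Lemma prob_split_mem (E : set T) i (s : seq int) : measurable E -> used_idx i -> uniq s ->
  Pr (E `&` [set w | Y i w \in s]) = \sum_(v <- s) Pr (E `&` Y i @^-1` [set v]).
Proof.
move=> mE ui; elim: s => [|v s IHs] /=.
  move=> _; rewrite big_nil /Pr (_ : _ `&` _ = set0) ?measure0//.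
  by apply/seteqP; split=> w // -[].
move=> /andP[vs us]; rewrite big_cons -IHs// /Pr.
have mm v' : measurable (E `&` Y i @^-1` [set v']).
  by apply: measurableI => //; exact: base_measurable.
have ms : measurable (E `&` [set w | Y i w \in s]).
  apply: measurableI => //.
  exact: (preimage_countable (fun k => base_measurable k ui) [set v' | v' \in s]).
rewrite -fineD ?fin_num_measure// -measureU//.
- congr (fine (P _)); apply/seteqP; split=> w /=.
    by rewrite inE => -[Ew /orP[/eqP|]]; [left|right].
  by move=> [[Ew e]|[Ew e]]; split=> //; rewrite inE ?e ?eqxx ?orbT.
- by apply/seteqP; split=> w //= [[_ e] [_]]; rewrite e (negbTE vs).
Qed.

(** The model prescribes only the probabilities of the expected values. As these add up to 1, all
    other values form a null event, and total probability over [s] loses nothing. *)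
Lemma prob_split (E : set T) i (s : seq int) : measurable E -> used_idx i -> uniq s ->
  \sum_(v <- s) Pr (Y i @^-1` [set v]) = 1 ->
  Pr E = \sum_(v <- s) Pr (E `&` Y i @^-1` [set v]).
Proof.
move=> mE ui us s1; rewrite -prob_split_mem//.
have ms : measurable [set w | Y i w \in s].
  exact: (preimage_countable (fun k => base_measurable k ui) [set v' | v' \in s]).
have P1 : P [set w | Y i w \in s] = 1%E.
  rewrite prE// -(setTI [set w | _]) prob_split_mem//.
  by under eq_bigr do rewrite setTI; rewrite s1.
have P0 : P (~` [set w | Y i w \in s]) = 0%E by rewrite probability_setC// P1 subee.
rewrite /Pr; congr fine.
rewrite -[in LHS](setIT E) -(setUv [set w | Y i w \in s]) setIUr measureU//.
- rewrite [X in (_ + X)%E](_ : _ = 0%E) ?adde0//.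
  apply: (subset_measure0 _ _ (@subIsetr _ E _)) P0.
    by apply: measurableI => //; exact: measurableC.
  exact: measurableC.
- exact: measurableI.
- by apply: measurableI => //; exact: measurableC.
- by apply/seteqP; split=> w //= [[_ ?] [_]].
Qed.

Definition btime (i : bidx) : nat :=
  match i with bX1 | bX2 => 0 | bU1 k | bU2 k | bA1 k | bA2 k => k end.

Lemma future_used m s : all (fun i => m.+2 < btime i)%N s -> all used_idx s.
Proof.
by apply: sub_all => -[||k|k|k|k] //= h; apply: leq_ltn_trans h.
Qed.

Lemma Pr_rad m b : b \in [:: 1; -1] ->
  Pr (Y (bA1 m.+3) @^-1` [set b]) = rad_weight p b /\
  Pr (Y (bA2 m.+3) @^-1` [set b]) = rad_weight p b.
Proof.
have [_ _ _ _ h] := model; have [[h1 h2] [h3 h4]] := h m.+2 isT.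
by rewrite !inE => /orP[] /eqP ->; rewrite /Pr /= ?h1 ?h2 ?h3 ?h4.
Qed.

Lemma Pr_unif m v : v \in indices m.+2 ->
  Pr (Y (bU1 m.+3) @^-1` [set v]) = m.+2%:R^-1 /\
  Pr (Y (bU2 m.+3) @^-1` [set v]) = m.+2%:R^-1.
Proof.
have [_ _ _ h _] := model; have [h1 h2] := h m.+2 isT.
move=> /mapP[j]; rewrite mem_iota add0n => /andP[_ jm] ->.
by rewrite /Pr /= ?h1 ?h2.
Qed.

Lemma Pr_first v : v \in [:: 1; -1] ->
  Pr (Y bX1 @^-1` [set v]) = 2^-1 /\ Pr (Y bX2 @^-1` [set v]) = 2^-1.
Proof.
have [_ _ [[h1 h2] [h3 h4]] _ _] := model.
rewrite !inE => /orP[] /eqP ->; rewrite /Pr /= ?h1 ?h2 ?h3 ?h4 /=; split; lra.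
Qed.

Lemma uniq_indices n : uniq (indices n).
Proof. by rewrite map_inj_uniq ?iota_uniq// => i j []. Qed.

Lemma sum_rad : \sum_(b <- [:: 1; -1]) rad_weight p b = 1.
Proof. by rewrite !big_cons big_nil /rad_weight /=; ring. Qed.

Lemma sum_unif n : \sum_(v <- indices n.+1) (n.+1%:R^-1 : R) = 1.
Proof.
rewrite big_const_seq count_predT size_map size_iota iter_addr_0.
by rewrite -[LHS]mulr_natr mulVf// pnatr_eq0.
Qed.

Definition indic (B : pred (seq int)) (l : seq int) : R := (B l)%:R.

(** The cylinder of later variables carries the induction: it expresses that the walk up to time m +
    2 is independent of all later draws. To advance by one step, the four new draws are moved from
    the event on the walk into the cylinder. *)
Lemma walk_law m (B : pred (seq int)) fs :
  uniq (map fst fs) -> all (fun i => m.+2 < btime i)%N (map fst fs) ->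
  Pr (W m.+2 @^-1` [set l | B l] `&` cylinder fs) = law p m (indic B) * weight fs.
Proof.
elim: m B fs => [|m IHm] B fs ufs ffs.
  have fresh i : ~~ (2 < btime i)%N -> i \notin map fst fs.
    by move=> hi; apply/negP => /(allP ffs); exact/negP.
  have mC := cylinder_measurable (future_used ffs).
  have mE : measurable (W 2 @^-1` [set l | B l] `&` cylinder fs).
    by apply: measurableI => //; exact: walk_measurable.
  have sX1 : \sum_(v <- [:: 1; -1]) Pr (Y bX1 @^-1` [set v]) = 1.
    by rewrite !big_cons big_nil !(proj1 (Pr_first _))//; lra.
  have sX2 : \sum_(v <- [:: 1; -1]) Pr (Y bX2 @^-1` [set v]) = 1.
    by rewrite !big_cons big_nil !(proj2 (Pr_first _))//; lra.
  have key v1 v2 : v1 \in [:: 1; -1] -> v2 \in [:: 1; -1] ->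
      Pr (W 2 @^-1` [set l | B l] `&` cylinder fs `&` Y bX1 @^-1` [set v1]
        `&` Y bX2 @^-1` [set v2]) = indic B [:: v1; v2] / 4 * weight fs.
    move=> v1s v2s; rewrite /indic; case: (boolP (B [:: v1; v2])) => Bv.
      have -> : W 2 @^-1` [set l | B l] `&` cylinder fs `&` Y bX1 @^-1` [set v1]
        `&` Y bX2 @^-1` [set v2] = cylinder ((bX1, v1) :: (bX2, v2) :: fs).
        rewrite /cylinder !big_cons; apply/seteqP; split=> w.
          by move=> [[[_ h] e1] e2]; split.
        move=> [e1 [e2 h]]; split => //; split => //; split => //=.
        by rewrite /W /walk_at /= (e1 : x1 w = v1) (e2 : x2 w = v2).
      rewrite cylinder_prob /=.
      - rewrite /weight !big_cons /= (proj1 (Pr_first v1s)) (proj2 (Pr_first v2s)).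
        by field.
      - by rewrite ufs andbT in_cons negb_or !fresh// !andbT; apply/eqP.
      - exact: (@future_used 0) ffs.
    rewrite mul0r mul0r /Pr (_ : _ `&` _ = set0) ?measure0//.
    apply/seteqP; split=> w // -[[[h _] e1] e2]; move: h => /=.
    by rewrite /W /walk_at /= (e1 : x1 w = v1) (e2 : x2 w = v2) (negbTE Bv).
  rewrite (prob_split mE (i := bX1) _ _ sX1)// !big_cons big_nil.
  rewrite !(prob_split _ (i := bX2) _ _ sX2)//.
  - by rewrite !big_cons !big_nil !key//=; field.
  - by apply: measurableI => //; exact: base_measurable.
  - by apply: measurableI => //; exact: base_measurable.
have fresh i : ~~ (m.+3 < btime i)%N -> i \notin map fst fs.
  by move=> hi; apply/negP => /(allP ffs); exact/negP.
have ffs' : all (fun i => m.+2 < btime i)%N (map fst fs).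
  by apply: sub_all ffs => i; apply: ltn_trans.
have mC := cylinder_measurable (future_used ffs').
pose E := W m.+3 @^-1` [set l | B l] `&` cylinder fs.
have mE : measurable E by apply: measurableI => //; exact: walk_measurable.
pose B' b1 j1 b2 j2 l :=
  B (rcons l (clip (b1 * nth 0 l (absz j1).-1 + b2 * nth 0 l (absz j2).-1))).
pose k := m.+3.
have key b1 j1 b2 j2 : b1 \in [:: 1; -1] -> j1 \in indices m.+2 ->
    b2 \in [:: 1; -1] -> j2 \in indices m.+2 ->
    Pr (E `&` Y (bA1 k) @^-1` [set b1] `&` Y (bU1 k) @^-1` [set j1]
          `&` Y (bA2 k) @^-1` [set b2] `&` Y (bU2 k) @^-1` [set j2]) =
    law p m (fun l => rad_weight p b1 * m.+2%:R^-1 * (rad_weight p b2 * m.+2%:R^-1)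
      * indic (B' b1 j1 b2 j2) l) * weight fs.
  move=> b1s j1s b2s j2s.
  pose fs' := [:: (bA1 k, b1), (bU1 k, j1), (bA2 k, b2), (bU2 k, j2) & fs].
  have -> : E `&` Y (bA1 k) @^-1` [set b1] `&` Y (bU1 k) @^-1` [set j1]
          `&` Y (bA2 k) @^-1` [set b2] `&` Y (bU2 k) @^-1` [set j2] =
      W m.+2 @^-1` [set l | B' b1 j1 b2 j2 l] `&` cylinder fs'.
    rewrite /cylinder !big_cons; apply/seteqP; split=> w.
      move=> [[[[[h hc] e1] e2] e3] e4]; split; last by [].
      move: h; rewrite /B' /= /W /walk_at /= -/(walk_at x1 x2 u1 u2 a1 a2 m.+2 w).
      by rewrite (e1 : a1 k w = _) (e2 : u1 k w = _) (e3 : a2 k w = _) (e4 : u2 k w = _).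
    move=> [h [e1 [e2 [e3 [e4 hc]]]]]; do 5 (split; last by []).
    move: h; rewrite /B' /= /W /walk_at /= -/(walk_at x1 x2 u1 u2 a1 a2 m.+2 w).
    by rewrite (e1 : a1 k w = _) (e2 : u1 k w = _) (e3 : a2 k w = _) (e4 : u2 k w = _).
  rewrite IHm.
  - rewrite lawZ// /fs' /weight !big_cons /= -/k (proj1 (Pr_rad m b1s)) (proj2 (Pr_rad m b2s)).
    by rewrite (proj1 (Pr_unif j1s)) (proj2 (Pr_unif j2s)); ring.
  - rewrite /= ufs andbT !in_cons /=.
    by rewrite !negb_or !fresh /= /k ?ltnn// !andbT; repeat (apply/andP; split); case: pselect.
  - by rewrite /= ffs' andbT !ltnSn.
have sA1 : \sum_(v <- [:: 1; -1]) Pr (Y (bA1 k) @^-1` [set v]) = 1.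
  by rewrite -[RHS]sum_rad; apply: eq_big_seq => v /(Pr_rad m)[].
have sA2 : \sum_(v <- [:: 1; -1]) Pr (Y (bA2 k) @^-1` [set v]) = 1.
  by rewrite -[RHS]sum_rad; apply: eq_big_seq => v /(Pr_rad m)[].
have sU1 : \sum_(v <- indices m.+2) Pr (Y (bU1 k) @^-1` [set v]) = 1.
  by rewrite -[RHS](sum_unif m.+1); apply: eq_big_seq => v /Pr_unif[].
have sU2 : \sum_(v <- indices m.+2) Pr (Y (bU2 k) @^-1` [set v]) = 1.
  by rewrite -[RHS](sum_unif m.+1); apply: eq_big_seq => v /Pr_unif[].
have mI i v (F : set T) : used_idx i -> measurable F -> measurable (F `&` Y i @^-1` [set v]).
  by move=> ui mF; apply: measurableI => //; exact: base_measurable.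
(* Total probability over the four draws; linearity of [law] and [two_channels] then recognise the
   sum as [step_mean]. *)
transitivity (\sum_(b1 <- [:: 1; -1]) \sum_(j1 <- indices m.+2)
  \sum_(b2 <- [:: 1; -1]) \sum_(j2 <- indices m.+2)
    law p m (fun l => rad_weight p b1 * m.+2%:R^-1 * (rad_weight p b2 * m.+2%:R^-1)
      * indic (B' b1 j1 b2 j2) l) * weight fs).
  rewrite (prob_split mE (i := bA1 k) _ _ sA1)//; apply: eq_big_seq => b1 b1s.
  rewrite (prob_split _ (i := bU1 k) _ _ sU1) ?uniq_indices//; last exact: mI.
  apply: eq_big_seq => j1 j1s.
  rewrite (prob_split _ (i := bA2 k) _ _ sA2)//; last by do 2 (apply: (mI) => //).
  apply: eq_big_seq => b2 b2s.
  rewrite (prob_split _ (i := bU2 k) _ _ sU2) ?uniq_indices//.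
    by apply: eq_big_seq => j2 j2s; exact: key.
  by do 3 (apply: (mI) => //).
under eq_bigr => b1 _ do under eq_bigr => j1 _ do under eq_bigr => b2 _ do
  rewrite -mulr_suml -law_sum//.
under eq_bigr => b1 _ do under eq_bigr => j1 _ do rewrite -mulr_suml -law_sum//.
under eq_bigr => b1 _ do rewrite -mulr_suml -law_sum//.
rewrite -mulr_suml -law_sum//=; congr (_ * _); apply: eq_law => // l /and3P[/eqP sl al _].
have l0 : l != [::] by rewrite -size_eq0 sl.
by rewrite /step_mean -sl -(two_channels p (fun x => indic B (rcons l x)) al l0).
Qed.

End WalkLaw.

(** * Expectations and almost sure statements *)

Section WalkMean.
Context {R : realType} {d : measure_display} {T : measurableType d}
  (P : probability T R) (p : R) (x1 x2 : T -> int) (u1 u2 a1 a2 : nat -> T -> int).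
Hypothesis p01 : 0 < p < 1.
Hypothesis model : two_channel_model P p x1 x2 u1 u2 a1 a2.

Let W := walk_at x1 x2 u1 u2 a1 a2.

Lemma walk_prob m (B : pred (seq int)) :
  P (W m.+2 @^-1` [set l | B l]) = (law p m (indic B))%:E.
Proof.
have mE : measurable (W m.+2 @^-1` [set l | B l]) by exact: walk_measurable model _ _.
have := @walk_law _ _ _ _ _ _ _ _ _ _ _ p01 model m B [::] isT isT.
rewrite /cylinder /weight !big_nil setIT mulr1 => <-.
by rewrite fineK// fin_num_measure.
Qed.

(** Clipping makes every later step a letter, but X_1 and X_2 may leave {1, -1} on a null event. *)
Lemma ae_path_ok : {ae P, forall w, forall m, path_ok m (W m.+2 w)}.
Proof.
apply: ae_foralln => m.
exists (~` (W m.+2 @^-1` [set l | path_ok m l])).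
have mE : measurable (W m.+2 @^-1` [set l | path_ok m l]).
  exact: walk_measurable model _ _.
have P0 : P (~` (W m.+2 @^-1` [set l | path_ok m l])) = 0%E.
  rewrite probability_setC// walk_prob (_ : law p m _ = 1) ?subee//.
  by rewrite -[RHS](law_cst p01 m); apply: eq_law => // l lok; rewrite /indic lok.
by split; [exact: measurableC|exact: P0|].
Qed.

Fixpoint words n : seq (seq int) :=
  if n is n'.+1 then [seq x :: l | x <- letters, l <- words n'] else [:: [::]].

Arguments words : simpl never.

Lemma words_uniq n : uniq (words n).
Proof.
elim: n => // n IHn.
have -> : words n.+1 = [seq x :: l | x <- letters, l <- words n] by [].
apply: allpairs_uniq => //.
by move=> [x l] [y l'] _ _ /= [-> ->].
Qed.

Lemma mem_words l : all (mem letters) l -> l \in words (size l).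
Proof.
elim: l => // x l IHl /andP[xl /IHl lw].
have -> : words (size (x :: l)) = [seq y :: l' | y <- letters, l' <- words (size l)] by [].
by apply/allpairsP; exists (x, l).
Qed.

Lemma words_decomp m l (g : seq int -> R) : path_ok m l ->
  g l = \sum_(l' <- words m.+2) g l' * indic (pred1 l') l.
Proof.
case/and3P => /eqP sl al _; have := mem_words al; rewrite sl => lw.
rewrite (bigD1_seq l)//= ?words_uniq// big1 ?addr0.
  by rewrite /indic /= eqxx mulr1.
by move=> l' ll'; rewrite /indic /= eq_sym (negbTE ll') mulr0.
Qed.

Lemma walk_measurable_fun m (g : seq int -> R) :
  measurable_fun setT (fun w => g (W m.+2 w)).
Proof.
move=> _ B mB; rewrite setTI.
exact: (walk_measurable model m [set l | B (g l)]).
Qed.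

(** On admissible paths the integrand is a finite combination of indicators of words, so linearity
    reduces the claim to [walk_prob]. *)
Lemma walk_integral m (g : seq int -> R) :
  (\int[P]_w (g (W m.+2 w))%:E)%E = (law p m g)%:E.
Proof.
pose A l := W m.+2 @^-1` [set l' | pred1 l l'].
have mA l : measurable (A l) by exact: walk_measurable model _ _.
have iA l : P.-integrable setT (EFin \o \1_(A l)).
  by apply: integrable_indic.
transitivity (\int[P]_w (\sum_(l <- words m.+2) (g l)%:E * (\1_(A l) w)%:E))%E.
  apply: ae_eq_integral => //.
  - by apply/measurable_EFinP; exact: walk_measurable_fun.
  - apply: emeasurable_sum => l; apply: measurable_funeM.
    by apply/measurable_EFinP; exact: measurable_indic.
  have [N [mN N0 hN]] := ae_path_ok; exists N; split => // w /=.
  move=> hw; apply: hN => /= hok; apply: hw => _.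
  rewrite (words_decomp g (hok m)) -sumEFin; apply: eq_bigr => l _.
  rewrite EFinM; congr (_ * _%:E)%E; rewrite /indic indicE /A.
  by congr (_%:R); rewrite mem_setE.
have iF l : P.-integrable setT (fun w => ((g l)%:E * (\1_(A l) w)%:E)%E).
  exact: (integrableZl measurableT (g l) (iA l)).
rewrite (integral_sum measurableT iF).
rewrite (eq_bigr (fun l => (g l * law p m (indic (pred1 l)))%:E)); last first.
  move=> l _; rewrite (integralZl measurableT (iA l)) EFinM; congr (_ * _)%E.
  rewrite (integral_indic _ measurableT (mA l)) setIT.
  exact: walk_prob.
rewrite sumEFin; congr EFin.
rewrite -(eq_law p01 (fun l lok => esym (words_decomp g lok))) law_sum//.
by apply: eq_bigr => l _; rewrite lawZ.
Qed.

(** By Tonelli the whole series has expectation at most M; it is therefore almost surely finite, and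
    its value bounds the partial sums. *)
Lemma ae_bsum (g : nat -> seq int -> R) : (forall m l, 0 <= g m l) ->
  bsum (fun m => law p m (g m)) ->
  {ae P, forall w, bsum (fun m => g m (W m.+2 w))}.
Proof.
move=> g0 [M hM].
pose F w := (\sum_(0 <= m <oo) (g m (W m.+2 w))%:E)%E.
have mg m : measurable_fun setT (fun w => (g m (W m.+2 w))%:E).
  by apply/measurable_EFinP; exact: walk_measurable_fun.
have gE m w : (0 <= (g m (W m.+2 w))%:E)%E by rewrite lee_fin.
have F0 w : (0 <= F w)%E by apply: nneseries_ge0 => m _ _.
have iF : P.-integrable setT F.
  apply/integrableP; split.
    by apply: ge0_emeasurable_sum => //.
  rewrite (eq_integral F); last by move=> w _; rewrite gee0_abs.
  rewrite integral_nneseries//; apply: (@le_lt_trans _ _ M%:E); last exact: ltry.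
  apply: lime_le.
    by apply: is_cvg_nneseries => m _ _; apply: integral_ge0 => w _.
  apply: nearW => n; rewrite (eq_bigr (fun m => (law p m (g m))%:E)).
    by rewrite sumEFin lee_fin big_mkord; exact: hM.
  by move=> m _; rewrite walk_integral.
have := integrable_ae measurableT iF; apply: filterS => w /(_ I) hF.
exists (fine (F w)) => n; rewrite -lee_fin fineK// -sumEFin.
have := @nneseries_lim_ge R (fun m => (g m (W m.+2 w))%:E) xpredT 0 n (fun m _ _ => gE m w).
by rewrite big_mkord.
Qed.

(** The elementary conditional expectation divides by the probability of an atom. At each time the
    words of probability 0 are finitely many up to a null event, so the walk almost surely avoids
    them. *)
Lemma ae_prob_gt0 :
  {ae P, forall w, forall m, P (W m.+2 @^-1` [set l | l == W m.+2 w]) != 0%E}.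
Proof.
apply: ae_foralln => m.
pose B : pred (seq int) := fun l => P (W m.+2 @^-1` [set l' | l' == l]) == 0%E.
have P0 : P (W m.+2 @^-1` [set l | B l]) = 0%E.
  rewrite walk_prob -(eq_law p01 (fun l lok => esym (words_decomp (indic B) lok))).
  rewrite law_sum// big1// => l _; rewrite lawZ//.
  have [Bl|nBl] := boolP (B l); last by rewrite /indic (negbTE nBl) mul0r.
  have := eqP Bl; rewrite (walk_prob m (pred1 l)) => -[->].
  by rewrite mulr0.
exists (W m.+2 @^-1` [set l | B l]); split.
- exact: walk_measurable model _ _.
- exact: P0.
- by move=> w /= /negP; rewrite negbK.
Qed.

End WalkMean.

(** * Conditional covariance *)

Lemma clip_letters t : clip t \in letters.
Proof.
have : t <= -1 \/ t = 0 \/ 1 <= t by lia.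
rewrite /clip => -[t1|[->|t1]]; last by rewrite min_l.
  by rewrite min_r ?max_l//; lia.
by [].
Qed.

Section ConditionalCovariance.
Context {R : realType} {d : measure_display} {T : measurableType d}
  (P : probability T R) (p : R) (x1 x2 : T -> int) (u1 u2 a1 a2 : nat -> T -> int).
Hypothesis p01 : 0 < p < 1.
Hypothesis model : two_channel_model P p x1 x2 u1 u2 a1 a2.

Let W := walk_at x1 x2 u1 u2 a1 a2.

Lemma walk_rcons m w : exists2 x, x \in letters & W m.+3 w = rcons (W m.+2 w) x.
Proof.
exists (clip (a1 m.+3 w * nth 0 (W m.+2 w) (absz (u1 m.+3 w)).-1 +
  a2 m.+3 w * nth 0 (W m.+2 w) (absz (u2 m.+3 w)).-1)); first exact: clip_letters.
reflexivity.
Qed.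

Lemma size_walk n w : size (W n w) = n.
Proof.
case: n => [|[|m]] //; elim: m => [|m IHm] //.
by have [x _ ->] := walk_rcons m w; rewrite size_rcons IHm.
Qed.

Lemma take_walk k m w : (k <= m.+2)%N -> W k w = take k (W m.+2 w).
Proof.
elim: m => [|m IHm]; first by case: k => [|[|[|k]]].
rewrite leq_eqVlt => /orP[/eqP ->|km]; first by rewrite take_oversize ?size_walk.
have [x _ ->] := walk_rcons m w; rewrite IHm// -cats1 takel_cat// size_walk.
exact: km.
Qed.

Definition freq_vec (l : seq int) : 'cV[R]_2 := vec2 (freq 1 l) (freq (-1) l).

Lemma Gamma_freq_vec n w : Gamma R x1 x2 u1 u2 a1 a2 n w = freq_vec (W n w).
Proof. by rewrite /Gamma /freq_vec /freq size_walk. Qed.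

Definition history n l := [seq freq_vec (take k l) | k <- iota 1 n].

Lemma key_history m w :
  [seq Gamma R x1 x2 u1 u2 a1 a2 k w | k <- iota 1 m.+2] = history m.+2 (W m.+2 w).
Proof.
apply/eq_in_map => k; rewrite mem_iota => /andP[_ km].
by rewrite Gamma_freq_vec (take_walk (m := m)).
Qed.

Lemma history_freq m l l' : size l = m.+2 -> size l' = m.+2 ->
  history m.+2 l = history m.+2 l' -> freq 1 l = freq 1 l' :> R /\ freq (-1) l = freq (-1) l' :> R.
Proof.
move=> sl sl' /(congr1 (fun s => nth 0 s m.+1)).
rewrite !(nth_map 0%N) ?size_iota// !nth_iota// add1n -{1}sl -{1}sl' !take_size.
move=> /matrixP h; split.
  by have := h 0 0; rewrite !mxE.
by have := h 1 0; rewrite !mxE.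
Qed.

Definition noise m (l : seq int) : 'cV[R]_2 :=
  m.+3%:R *: (freq_vec l - freq_vec (take m.+2 l)) - h_p p (freq_vec (take m.+2 l)).

Definition step_probs (l : seq int) : 'cV[R]_2 :=
  vec2 (up_prob p (freq 1 l) (freq (-1) l)) (up_prob p (freq (-1) l) (freq 1 l)).

Lemma e_vec_noise m w : e_vec p x1 x2 u1 u2 a1 a2 m.+3 w = noise m (W m.+3 w).
Proof.
by rewrite /noise -(take_walk (k := m.+2) (m := m.+1))// /e_vec !Gamma_freq_vec.
Qed.

(** [h_p] is the vector of step probabilities minus the frequencies, so e_{n+1} is the indicator
    vector of the new step minus its conditional mean. *)
Lemma noise_rcons m l x i : size l = m.+2 ->
  noise m (rcons l x) i 0 =
  (if (i : nat) == 0%N then (x == 1)%:R - up_prob p (freq 1 l) (freq (-1) l)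
   else (x == -1)%:R - up_prob p (freq (-1) l) (freq 1 l)).
Proof.
move=> sl; have tl : take m.+2 (rcons l x) = l.
  by rewrite -cats1 takel_cat ?sl// -sl take_size.
have n0 : m.+2%:R != 0 :> R by rewrite pnatr_eq0.
have n1 : m.+3%:R = m.+2%:R + 1 :> R by rewrite -natr1.
have n2 : m.+2%:R + 1 != 0 :> R by rewrite -n1 pnatr_eq0.
rewrite /noise tl /freq_vec /h_p !mxE /= /up_prob /freq size_rcons sl.
rewrite -cats1 !count_cat /= !addn0 !natrD n1.
move: (m.+2%:R : R) n0 n2 {n1} => k n0 n2.
by case: ifP => _; field; rewrite ?n2 ?n0.
Qed.

(** The indicators of two disjoint events of probabilities u and v have covariance matrix sigma at
    (u, v). The event [B] concerns only the past and factors out. *)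
Lemma step_mean_noise m l i j (B : pred (seq int)) : path_ok m l ->
  step_mean p (fun l' => indic B (take m.+2 l') * (noise m l' *m (noise m l')^T) i j) l
  = indic B l * sigma_mx (step_probs l) i j.
Proof.
move=> /and3P[/eqP sl _ _].
have tl x : take m.+2 (rcons l x) = l.
  by rewrite -cats1 takel_cat ?sl// -sl take_size.
have nn x : (noise m (rcons l x) *m (noise m (rcons l x))^T) i j =
    noise m (rcons l x) i 0 * noise m (rcons l x) j 0.
  by rewrite mxE big_ord1; congr (_ * _); rewrite mxE.
rewrite /step_mean !tl !nn !noise_rcons// /sigma_mx mxE /step_probs !mxE /=.
case: ((i : nat) == 0%N); case: ((j : nat) == 0%N) => /=; ring.
Qed.

(** The last entry of the history determines the current frequencies, so [step_probs] is constant on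
    the atom and comes out of the integral. The atom contains the event of the single word W, hence
    has positive probability. *)
Lemma cond_cov_walk m w : path_ok m (W m.+2 w) ->
  P (W m.+2 @^-1` [set l | l == W m.+2 w]) != 0%E ->
  cond_cov P p x1 x2 u1 u2 a1 a2 m.+2 w = sigma_mx (step_probs (W m.+2 w)).
Proof.
move=> wok wpos; apply/matrixP => i j; rewrite mxE /cond_exp_discrete.
pose B : pred (seq int) := fun l => history m.+2 l == history m.+2 (W m.+2 w).
set A := [set x | _].
have EA : A = W m.+2 @^-1` [set l | B l].
  apply/seteqP; split=> x.
    move=> h; apply/eqP.
    exact: (etrans (esym (key_history m x)) (etrans h (key_history m w))).
  move=> /eqP h.
  exact: (etrans (key_history m x) (etrans h (esym (key_history m w)))).
have mA : measurable A by rewrite EA; exact: walk_measurable model _ _.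
pose c := sigma_mx (step_probs (W m.+2 w)) i j.
pose L := law p m (indic (R := R) B).
have PA : P A = L%:E by rewrite EA; exact: walk_prob.
have L0 : L != 0.
  apply: contra wpos => /eqP L0; rewrite L0 in PA.
  apply/eqP; apply: (subset_measure0 _ mA _ PA).
    exact: (walk_measurable model m [set l | l == W m.+2 w]).
  by rewrite EA => x /= /eqP ->; rewrite /B eqxx.
have -> : (\int[P]_(x in A) ((e_vec p x1 x2 u1 u2 a1 a2 m.+3 x *m
    (e_vec p x1 x2 u1 u2 a1 a2 m.+3 x)^T) i j)%:E)%E = (c * L)%:E.
  rewrite integral_mkcond.
  transitivity (\int[P]_x (indic B (take m.+2 (W m.+3 x)) *
     (noise m (W m.+3 x) *m (noise m (W m.+3 x))^T) i j)%:E)%E.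
    apply: eq_integral => x _; rewrite patchE e_vec_noise EA.
    rewrite -(take_walk (k := m.+2) (m := m.+1))// /indic.
    have [Bx|nBx] := boolP (B (W m.+2 x)); last by rewrite memNset ?mul0r//; exact/negP.
    by rewrite mem_set// mul1r.
  rewrite (walk_integral p01 model m.+1 (fun l => indic B (take m.+2 l) *
     (noise m l *m (noise m l)^T) i j)) /= /L -lawZ//.
  congr EFin; apply: eq_law => // l lok; rewrite step_mean_noise// mulrC /indic.
  have [/eqP Bl|_] := boolP (B l); last by rewrite !mulr0.
  rewrite !mulr1 /c /step_probs.
  have sl : size l = m.+2 by case/and3P: lok => /eqP.
  by have [-> ->] := history_freq sl (size_walk _ _) Bl.
by rewrite PA /= mulfK.
Qed.

End ConditionalCovariance.

(** * Pathwise convergence *)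

Section PathConvergence.
Context {R : realType}.

Lemma cvg_mx_entries (m n : nat) (F : nat -> 'M[R]_(m, n)) (L : 'M[R]_(m, n)) :
  (forall i j, (fun k => F k i j) @ \oo --> L i j) -> F @ \oo --> L.
Proof.
move=> h; apply/cvg_mx_entourageP => A entA.
apply: filter_forall => i; apply: filter_forall => j.
have h' : \forall k \near \oo, A (L i j, F k i j).
  exact: ((cvg_entourageP _ _).1 (h i j) A entA).
by apply: (filterS _ h') => k; exact: mem_set.
Qed.

Lemma cvg_mx_entry (m n : nat) (F : nat -> 'M[R]_(m, n)) (L : 'M[R]_(m, n)) i j :
  F @ \oo --> L -> (fun k => F k i j) @ \oo --> L i j.
Proof.
move=> /cvg_mx_entourageP h; apply/cvg_entourageP => A entA.
have h' : \forall k \near \oo, forall i j, (L i j, F k i j) \in A by exact: h.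
have : \forall k \near \oo, A (L i j, F k i j).
  by apply: (filterS _ h') => k /(_ i j); exact: set_mem.
exact.
Qed.

Lemma sqr_cvg0 (f : nat -> R) : (fun n => f n ^+ 2) @ \oo --> (0 : R) -> f @ \oo --> (0 : R).
Proof.
move=> f2; apply: norm_cvg0.
have := cvg_comp _ _ f2 (@sqrt_continuous R 0); rewrite sqrtr0.
rewrite (_ : _ \o _ = fun n => `|f n|)//.
by apply/funext => n /=; rewrite sqrtr_sqr.
Qed.

Lemma nonneg_add_cvg0 (f g : nat -> R) : (forall n, 0 <= f n) -> (forall n, 0 <= g n) ->
  (fun n => f n + g n) @ \oo --> (0 : R) -> f @ \oo --> (0 : R).
Proof.
move=> f0 g0 fg; apply: (squeeze_cvgr _ (cvg_cst 0) fg).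
by apply: nearW => n; rewrite f0 lerDl g0.
Qed.

(* Steps shrinking to [0] cannot jump between neighbourhoods of the two roots. *)
Lemma sqr_cvg_sign (s : nat -> R) (r C : R) : 0 < r ->
  (fun n => s n ^+ 2) @ \oo --> r ->
  (forall n, `|s n.+1 - s n| <= C / n.+2%:R) ->
  s @ \oo --> Num.sqrt r \/ s @ \oo --> - Num.sqrt r.
Proof.
move=> r0 s2 hs; pose dl := Num.sqrt r / 2.
have sr0 : 0 < Num.sqrt r by rewrite sqrtr_gt0.
have dl0 : 0 < dl by rewrite divr_gt0.
have dl2 : dl ^+ 2 = r / 4 by rewrite /dl expr_div_n sqr_sqrtr ?ltW//; field.
have [n1 _ hn1] : \forall n \near \oo, r / 4 < s n ^+ 2.
  by apply: (cvgr_gt r s2); lra.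
have [n2 _ hn2] : \forall n \near \oo, C / n.+2%:R < 2 * dl.
  have h : (fun n => C / n.+2%:R) @ \oo --> (0 : R).
    rewrite -(mulr0 C); apply: cvgMr.
    have := @cvg_harmonic R; rewrite -(cvg_shiftS _ (nbhs (0 : R))).
    by [].
  by apply: (cvgr_lt 0 h); rewrite mulr_gt0.
pose n0 := maxn n1 n2.
have big n : (n0 <= n)%N -> dl < `|s n|.
  move=> h; have := hn1 n (leq_trans (leq_maxl _ _) h).
  rewrite -dl2 /= => hlt; rewrite -(@ltr_pXn2r _ 2) ?nnegrE ?normr_ge0 ?(ltW dl0)//.
  by rewrite real_normK ?num_real.
have small n : (n0 <= n)%N -> `|s n.+1 - s n| < 2 * dl.
  by move=> h; apply: le_lt_trans (hs n) (hn2 n (leq_trans (leq_maxr _ _) h)).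
have pos : forall s' : nat -> R, (forall n, (n0 <= n)%N -> dl < `|s' n|) ->
    (forall n, (n0 <= n)%N -> `|s' n.+1 - s' n| < 2 * dl) ->
    (fun n => s' n ^+ 2) @ \oo --> r -> 0 < s' n0 -> s' @ \oo --> Num.sqrt r.
  move=> s' big' small' s2' h0.
  have hpos n : (n0 <= n)%N -> 0 < s' n.
    move=> /subnK <-; elim: (n - n0)%N => // k IHk; rewrite addSn.
    have b1 := big' (k + n0)%N (leq_addl _ _).
    have b2 := big' (k + n0).+1 (leqW (leq_addl _ _)).
    have b3 := small' (k + n0)%N (leq_addl _ _).
    rewrite gtr0_norm// in b1; move: b3; rewrite ltr_norml => /andP[b3 _].
    rewrite ltNge; apply/negP => neg.
    by rewrite ler0_norm// in b2; lra.
  have := cvg_comp _ _ s2' (@sqrt_continuous R r).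
  apply: cvg_trans; apply: near_eq_cvg; exists n0 => // n /= nn.
  by rewrite sqrtr_sqr gtr0_norm// hpos.
have [h|h] := ltP 0 (s n0); first by left; exact: pos.
right; rewrite -[X in X @ _]opprK; apply: cvgN; apply: pos.
- by move=> n /big; rewrite normrN.
- by move=> n /small; rewrite -opprD normrN.
- by under eq_fun do rewrite sqrrN.
- rewrite oppr_gt0 lt_neqAle h andbT; apply: contraTneq (big n0 (leqnn _)) => ->.
  by rewrite normr0 -leNgt ltW.
Qed.

Variable L : nat -> seq int.
Hypothesis Lok : forall m, path_ok m (L m).
Hypothesis Lstep : forall m, exists2 x, x \in letters & L m.+1 = rcons (L m) x.

Let s m : R := posn (L m) / m.+2%:R.
Let t m : R := moves (L m) / m.+2%:R.

Lemma path_bounds m : [/\ 0 <= t m, t m <= 1, -1 <= s m & s m <= 1].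
Proof.
have [_ N2 Nn SN] := @path_ok_state R _ _ (Lok m).
have n2 : 2 <= m.+2%:R :> R by rewrite ler_nat.
by have [t0 t1 _ s0 s1] := state_freq (And4 n2 N2 Nn SN); split.
Qed.

Lemma path_increments m :
  `|s m.+1 - s m| <= 2 / m.+2%:R /\ `|t m.+1 - t m| <= 2 / m.+2%:R.
Proof.
have [t0 t1 s0 s1] := path_bounds m.
have n0 : 0 < m.+2%:R :> R by rewrite ltr0n.
have n1 : m.+3%:R = m.+2%:R + 1 :> R by rewrite -natr1.
have h1 : 0 < (m.+2%:R + 1)^-1 :> R by rewrite invr_gt0 -n1 ltr0n.
have h2 : (m.+2%:R + 1)^-1 <= m.+2%:R^-1 :> R by rewrite lef_pV2 ?posrE -?n1 ?ltr0n// ler_nat.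
have bd (a : R) : -2 <= a -> a <= 2 -> `|a / (m.+2%:R + 1)| <= 2 / m.+2%:R.
  move=> a0 a1; rewrite normrM (gtr0_norm h1); apply: ler_pM => //.
  by rewrite ler_norml a0.
have upd (a b : R) : (a + b) / m.+3%:R - a / m.+2%:R = (b - a / m.+2%:R) / (m.+2%:R + 1).
  by rewrite n1 freq_update// addrC addKr.
have [x xl E] := Lstep m.
have [a [b [Ea Eb aa bb]]] : exists a b : R, [/\ posn (L m.+1) = posn (L m) + a,
    moves (L m.+1) = moves (L m) + b, -1 <= a <= 1 & 0 <= b <= 1].
  rewrite E /posn /moves -cats1 !count_cat /= !natrD; move: xl; rewrite !inE.
  move=> /or3P[] /eqP -> /=; [exists 1, 1|exists (-1), 1|exists 0, 0]; split; try lra;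
    by rewrite ?addr0; ring.
case/andP: aa => aa0 aa1; case/andP: bb => bb0 bb1.
by rewrite /s /t Ea Eb !upd; split; apply: bd; rewrite -/(s m) -/(t m); lra.
Qed.

Lemma path_cvg T r :
  bsum (fun m => ((t m - T) ^+ 2 + (s m ^+ 2 - r) ^+ 2) / m.+2%:R) ->
  t @ \oo --> T /\ (fun m => s m ^+ 2) @ \oo --> r.
Proof.
set U := fun m => (t m - T) ^+ 2 + (s m ^+ 2 - r) ^+ 2.
move=> hU.
have t20 n : 0 <= (t n - T) ^+ 2 by exact: sqr_ge0.
have s20 n : 0 <= (s n ^+ 2 - r) ^+ 2 by exact: sqr_ge0.
have U0 : U @ \oo --> (0 : R).
  (* In the factored increment of [U], s and t move by at most 2 / n, and the cofactors are bounded
     by 2 + 2 |T| for t, and by 2 and 2 + 2 |r| for s. *)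
  apply: (@slowly_varying_cvg0 _ U (2 * (2 + 2 * `|T|) + 2 * 2 * (2 + 2 * `|r|))) => //.
    by move=> n; exact: addr_ge0.
  move=> n; have [ds dt] := path_increments n.
  have [t0 t1 s0 s1] := path_bounds n; have [t0' t1' s0' s1'] := path_bounds n.+1.
  set h := n.+2%:R^-1 in ds dt *.
  have -> : U n.+1 - U n = (t n.+1 - t n) * (t n.+1 + t n - 2 * T) +
     (s n.+1 - s n) * (s n.+1 + s n) * (s n.+1 ^+ 2 + s n ^+ 2 - 2 * r).
    by rewrite /U; ring.
  apply: (le_trans (ler_normD _ _)); rewrite !normrM [leRHS]mulrDl; apply: lerD.
    rewrite [leRHS]mulrAC; apply: ler_pM => //.
    apply: (le_trans (ler_normB _ _)); apply: lerD; last by rewrite normrM ger0_norm.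
    by rewrite ger0_norm ?addr_ge0//; lra.
  rewrite [leRHS]mulrAC; apply: ler_pM => //.
    rewrite [leRHS]mulrAC; apply: ler_pM => //.
    by rewrite ler_norml; lra.
  apply: (le_trans (ler_normB _ _)); apply: lerD; last by rewrite normrM ger0_norm.
  have e1 : s n ^+ 2 <= 1 by rewrite -[leLHS]real_normK ?num_real// expr_le1// ler_norml s0.
  have e2 : s n.+1 ^+ 2 <= 1 by rewrite -[leLHS]real_normK ?num_real// expr_le1// ler_norml s0'.
  rewrite ger0_norm; first lra.
  by apply: addr_ge0; exact: sqr_ge0.
have shift (f : nat -> R) l : (fun n => f n - l) @ \oo --> (0 : R) -> f @ \oo --> l.
  by move=> h; apply: cvg_zero; exact: h.
split; apply: shift; apply: sqr_cvg0.
  exact: nonneg_add_cvg0 U0.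
by apply: nonneg_add_cvg0 (fun n => s20 n) (fun n => t20 n) _; under eq_fun do rewrite addrC.
Qed.

End PathConvergence.

(** * Almost sure limits of the frequencies and of the covariance *)

Section Limit.
Context {R : realType} {d : measure_display} {T : measurableType d}
  (P : probability T R) (p : R) (x1 x2 : T -> int) (u1 u2 a1 a2 : nat -> T -> int).
Hypothesis p01 : 0 < p < 1.
Hypothesis model : two_channel_model P p x1 x2 u1 u2 a1 a2.

Let W := walk_at x1 x2 u1 u2 a1 a2.
Let G := Gamma R x1 x2 u1 u2 a1 a2.
Let C := cond_cov P p x1 x2 u1 u2 a1 a2.
Let s m w : R := posn (W m.+2 w) / m.+2%:R.
Let t m w : R := moves (W m.+2 w) / m.+2%:R.

Definition point (tau sg : R) : 'cV[R]_2 := vec2 ((tau + sg) / 2) ((tau - sg) / 2).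

Lemma ae_state_cvg tau r :
  bsum (mean_at p (fun n S N => ((N / n - tau) ^+ 2 + ((S / n) ^+ 2 - r) ^+ 2) / n)) ->
  {ae P, forall w, (fun m => t m w) @ \oo --> tau /\ (fun m => s m w ^+ 2) @ \oo --> r}.
Proof.
set F := fun _ _ _ => _ => hF.
have F0 (m : nat) l : 0 <= on_state F l.
  by rewrite /on_state /F divr_ge0// addr_ge0 ?sqr_ge0.
have := ae_bsum p01 model F0 hF.
apply: filterS2 (ae_path_ok p01 model) => w hok hb.
apply: (@path_cvg R (fun m => W m.+2 w)) => //.
  by move=> m; exact: walk_rcons.
move: hb; congr bsum; apply/funext => m.
by rewrite /on_state /F; have [-> _ _ _] := @path_ok_state R _ _ (hok m).
Qed.

Lemma freqE m w : freq 1 (W m.+2 w) = (t m w + s m w) / 2 /\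
  freq (-1) (W m.+2 w) = (t m w - s m w) / 2.
Proof.
rewrite /freq size_walk /s /t /posn /moves -mulrDl -mulrBl.
by move: (m.+2%:R^-1) => i; split; field.
Qed.

Lemma Gamma_cvg w tau sg : (fun m => t m w) @ \oo --> tau ->
  (fun m => s m w) @ \oo --> sg -> (fun n => G n w) @ \oo --> point tau sg.
Proof.
move=> ht hs; rewrite -(cvg_shiftn 2); apply: cvg_mx_entries => i j.
have E m : G (m + 2)%N w i j = point (t m w) (s m w) i j.
  have [e1 e2] := freqE m w.
  by rewrite addn2 /G Gamma_freq_vec /freq_vec /point !mxE -/W e1 e2.
under eq_fun do rewrite E.
rewrite /point mxE; under eq_fun do rewrite mxE.
by case: ifP => _; apply: cvgMl; [exact: cvgD|exact: cvgB].
Qed.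

Lemma Gamma_entry w (g : 'cV[R]_2) i : (fun n => G n w) @ \oo --> g ->
  (fun m => freq_vec (W m.+2 w) i 0) @ \oo --> g i 0.
Proof.
rewrite -(cvg_shiftn 2) => /(@cvg_mx_entry _ _ _ _ _ i 0); apply: cvg_trans.
apply: near_eq_cvg; apply: nearW => m.
by rewrite /= addn2 /G Gamma_freq_vec.
Qed.

Lemma pos_cvg w (g : 'cV[R]_2) : (fun n => G n w) @ \oo --> g ->
  (fun m => s m w) @ \oo --> g 0 0 - g 1 0.
Proof.
move=> hg; have hd : (fun m => freq_vec (W m.+2 w) 0 0 - freq_vec (W m.+2 w) 1 0)
    @ \oo --> g 0 0 - g 1 0 by apply: cvgB; exact: Gamma_entry.
rewrite (_ : s^~ w = fun m => freq_vec (W m.+2 w) 0 0 - freq_vec (W m.+2 w) 1 0)//.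
apply/funext => m; have [e1 e2] := freqE m w.
by rewrite /freq_vec !mxE /= e1 e2; field.
Qed.

Lemma up_prob_cvg (x y : nat -> R) a b : x @ \oo --> a -> y @ \oo --> b ->
  (fun n => up_prob p (x n) (y n)) @ \oo --> up_prob p a b.
Proof.
move=> hx hy; rewrite /up_prob.
apply: cvgB; (under eq_fun do rewrite expr2); rewrite expr2; apply: cvgM.
- by apply: cvgB; [exact: cvg_cst|apply: cvgD; apply: cvgMr].
- by apply: cvgB; [exact: cvg_cst|apply: cvgD; apply: cvgMr].
- by apply: cvgB => //; apply: cvgB => //; exact: cvg_cst.
- by apply: cvgB => //; apply: cvgB => //; exact: cvg_cst.
Qed.

(** The covariance is sigma at the step probabilities, which converge by continuity to [up_prob] at
    the limit; the two fixed-point equations turn this into [g]. *)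
Lemma cov_cvg w (g : 'cV[R]_2) : (forall m, path_ok m (W m.+2 w)) ->
  (forall m, P (W m.+2 @^-1` [set l | l == W m.+2 w]) != 0%E) ->
  up_prob p (g 0 0) (g 1 0) = g 0 0 -> up_prob p (g 1 0) (g 0 0) = g 1 0 ->
  (fun n => G n w) @ \oo --> g -> (fun n => C n w) @ \oo --> sigma_mx g.
Proof.
move=> wok wpos g0 g1 hg; rewrite -(cvg_shiftn 2); apply: cvg_mx_entries => i j.
pose x m := freq 1 (W m.+2 w) : R; pose y m := freq (-1) (W m.+2 w) : R.
have hx : x @ \oo --> g 0 0.
  have := @Gamma_entry w g 0 hg; apply: cvg_trans; apply: near_eq_cvg.
  by apply: nearW => m; rewrite /freq_vec mxE.
have hy : y @ \oo --> g 1 0.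
  have := @Gamma_entry w g 1 hg; apply: cvg_trans; apply: near_eq_cvg.
  by apply: nearW => m; rewrite /freq_vec mxE.
have hu := up_prob_cvg hx hy; have hv := up_prob_cvg hy hx.
rewrite g0 in hu; rewrite g1 in hv.
have E m : C (m + 2)%N w i j = sigma_mx (step_probs p (W m.+2 w)) i j.
  by rewrite addn2 /C cond_cov_walk.
under eq_fun do rewrite E.
rewrite /sigma_mx mxE; under eq_fun do rewrite mxE /step_probs !mxE /=.
case: ifP => _; case: ifP => _.
- by apply: cvgB => //; (under eq_fun do rewrite expr2); rewrite expr2; apply: cvgM.
- by apply: cvgN; apply: cvgM.
- by apply: cvgN; apply: cvgM.
- by apply: cvgB => //; (under eq_fun do rewrite expr2); rewrite expr2; apply: cvgM.
Qed.

Lemma ae_cov_cvg (g : 'cV[R]_2) : up_prob p (g 0 0) (g 1 0) = g 0 0 ->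
  up_prob p (g 1 0) (g 0 0) = g 1 0 ->
  {ae P, forall w, (fun n => G n w) @ \oo --> g -> (fun n => C n w) @ \oo --> sigma_mx g}.
Proof.
move=> g0 g1; apply: filterS2 (ae_path_ok p01 model) (ae_prob_gt0 p01 model).
by move=> w wok wpos; exact: cov_cvg.
Qed.

(** The defect of the fixed-point equation is half the sum of the two components of the flow, both
    of which vanish at an equilibrium. *)
Lemma up_prob_point tau sg :
  sg * ((2 * p - 1) * (2 - tau) - 1) = 0 ->
  tau - 3 / 2 * tau ^+ 2 + (2 * p - 1) ^+ 2 / 2 * sg ^+ 2 = 0 ->
  up_prob p ((tau + sg) / 2) ((tau - sg) / 2) = (tau + sg) / 2.
Proof.
move=> h1 h2; apply/eqP; rewrite -subr_eq0.
have -> : up_prob p ((tau + sg) / 2) ((tau - sg) / 2) - (tau + sg) / 2 =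
  ((tau - 3 / 2 * tau ^+ 2 + (2 * p - 1) ^+ 2 / 2 * sg ^+ 2)
   + sg * ((2 * p - 1) * (2 - tau) - 1)) / 2 by rewrite /up_prob; field.
by rewrite h1 h2 addr0 mul0r.
Qed.

Lemma ae_cov_point tau sg :
  sg * ((2 * p - 1) * (2 - tau) - 1) = 0 ->
  tau - 3 / 2 * tau ^+ 2 + (2 * p - 1) ^+ 2 / 2 * sg ^+ 2 = 0 ->
  {ae P, forall w, (fun n => G n w) @ \oo --> point tau sg ->
     (fun n => C n w) @ \oo --> sigma_mx (point tau sg)}.
Proof.
move=> h1 h2; apply: ae_cov_cvg; rewrite /point !mxE /=.
  exact: up_prob_point.
have := @up_prob_point tau (- sg); rewrite opprK; apply.
  by rewrite mulNr h1 oppr0.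
by rewrite sqrrN.
Qed.

(* By symmetry each sign of the position has probability at most [1/2] at every
   time, so neither can be almost surely the eventual one. *)
Lemma not_ae_eventually (e : bool) :
  ~ {ae P, forall w, exists n, forall m, (n <= m)%N ->
       if e then 0 < (posn (W m.+2 w) : R) else (posn (W m.+2 w) : R) < 0}.
Proof.
pose B (l : seq int) := if e then 0 < (posn l : R) else (posn l : R) < 0.
have half m : law p m (indic B) <= 1 / 2.
  pose f (n S N : R) : R := (0 < S)%R%:R; pose f' (n S N : R) : R := (S < 0)%R%:R.
  have sym : law p m (on_state f) = law p m (on_state f').
    rewrite law_sym//; apply: eq_law => // l _.
    by rewrite /on_state /f /f' oppr_gt0.
  have le1 : law p m (on_state f) + law p m (on_state f') <= 1.
    rewrite -lawD// -(law_cst p01 m 1); apply: law_le => // l _.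
    by rewrite /on_state /f /f'; case: (ltgtP (posn l : R) 0); rewrite ?addr0 ?add0r.
  have -> : law p m (indic B) = if e then law p m (on_state f) else law p m (on_state f').
    by rewrite /B /f /f'; clear; case: e.
  by case: (e); lra.
(* [E n] prescribes the sign from index n on. These events increase and each has probability at most
   1/2, so by continuity from below their union cannot have probability 1. *)
move=> ev; pose E n := \bigcap_(m in [set m | (n <= m)%N]) (W m.+2 @^-1` [set l | B l]).
have mE n : measurable (E n).
  by apply: bigcap_measurable => [|m _]; [exists n => /=|exact: walk_measurable model _ _].
have mU : measurable (\bigcup_n E n) by apply: bigcup_measurable => n _; exact: mE.
have EP n : (P (E n) <= (1 / 2)%:E)%E.
  apply: (@le_trans _ _ (P (W n.+2 @^-1` [set l | B l]))).
    by apply: le_measure; rewrite ?inE//;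
      [exact: walk_measurable model _ _|move=> w /(_ n (leqnn n))].
  by rewrite (walk_prob p01 model) lee_fin.
have UP : (P (\bigcup_n E n) <= (1 / 2)%:E)%E.
  have ndE : {homo E : n m / (n <= m)%N >-> (n <= m)%O}.
    move=> n m nm; apply/subsetPset => w Enw k /= mk.
    exact: Enw (leq_trans nm mk).
  have cE := nondecreasing_cvg_mu (mu := P) mE mU ndE.
  rewrite -(cvg_lim _ cE)//; apply: lime_le; first by apply/cvg_ex; eexists; exact: cE.
  by apply: nearW => n; exact: EP.
have : P (\bigcup_n E n) = 1%E.
  have [N [mN N0 hN]] := ev.
  have C0 : P (~` (\bigcup_n E n)) = 0%E.
    apply: (subset_measure0 _ mN _ N0); first exact: measurableC.
    by move=> w nU; apply: hN => -[n hn]; apply: nU; exists n => // m; exact: hn.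
  have := probability_setC P mU; rewrite C0 => h.
  have f1 : P (\bigcup_n E n) \is a fin_num by exact: fin_num_measure.
  move: h; rewrite -(fineK f1) -EFinB => -[h]; congr EFin; apply/eqP.
  by rewrite eq_sym -subr_eq0 -h.
by move=> U1; move: UP; rewrite U1 lee_fin; lra.
Qed.

Lemma eventually_sign w (g : 'cV[R]_2) (e : bool) : (fun n => G n w) @ \oo --> g ->
  (if e then 0 < g 0 0 - g 1 0 else g 0 0 - g 1 0 < 0) ->
  exists n, forall m, (n <= m)%N ->
       if e then 0 < (posn (W m.+2 w) : R) else (posn (W m.+2 w) : R) < 0.
Proof.
move=> /pos_cvg hs; case: e => hg.
  have [n _ hn] : \forall m \near \oo, 0 < s m w by exact: (cvgr_gt _ hs).
  exists n => m /hn /=; rewrite /s pmulr_lgt0//.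
have [n _ hn] : \forall m \near \oo, s m w < 0 by exact: (cvgr_lt _ hs).
exists n => m /hn /=; rewrite /s pmulr_llt0//.
Qed.

End Limit.

Unset Implicit Arguments.

Theorem theorem4p2 (R : realType) (d : measure_display) (T : measurableType d)
  (P : probability T R) (p : R)
  (x1 x2 : T -> int) (u1 u2 a1 a2 : nat -> T -> int) :
  0 < p < 1 -> p != 7 / 8 ->
  two_channel_model P p x1 x2 u1 u2 a1 a2 ->
  let G := Gamma R x1 x2 u1 u2 a1 a2 in
  let C := cond_cov P p x1 x2 u1 u2 a1 a2 in
  exists Gp : T -> 'cV[R]_2,
    {ae P, forall w, (fun n => G n w) @ \oo --> Gp w} /\
    (p < 7 / 8 ->
       {ae P, forall w, Gp w = gamma0 R} /\
       {ae P, forall w, Gp w = gamma0 R ->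
                 (fun n => C n w) @ \oo --> sigma_mx (gamma0 R)}) /\
    (7 / 8 < p ->
       {ae P, forall w, Gp w = gamma_p p \/ Gp w = gammabar_p p} /\
       ~ P.-negligible [set w | Gp w = gamma_p p] /\
       ~ P.-negligible [set w | Gp w = gammabar_p p] /\
       (forall g, g = gamma_p p \/ g = gammabar_p p ->
          {ae P, forall w, Gp w = g ->
                 (fun n => C n w) @ \oo --> sigma_mx g})).
Proof.
move=> p01 p78 model G C.
have [p_lt|p_gt] := ltP p (7 / 8).
  have g0E : gamma0 R = point (2 / 3) 0.
    by rewrite /gamma0 /point; congr vec2; field.
  have cvgG : {ae P, forall w, (fun n => G n w) @ \oo --> gamma0 R}.
    have := ae_state_cvg p01 model (center_summable p01 p_lt).
    apply: filterS => w [ht hs]; rewrite g0E; apply: Gamma_cvg => //.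
    exact: sqr_cvg0.
  exists (fun=> gamma0 R); split => //; split => [_|]; last by lra.
  split; first by apply: aeW.
  have z2 : 2 / 3 - 3 / 2 * (2 / 3) ^+ 2 + (2 * p - 1) ^+ 2 / 2 * 0 ^+ 2 = 0 :> R by field.
  have := ae_cov_point p01 model (mul0r _) z2; rewrite -g0E => covG.
  by apply: filterS2 cvgG covG => w h1 h2 _; exact: h2.
have {p78}p_gt : 7 / 8 < p by rewrite lt_neqAle eq_sym p78.
set q := 2 * p - 1.
have q34 : 3 / 4 < q by rewrite /q; lra.
have q1 : q <= 1 by case/andP: p01 => _; rewrite /q; lra.
have q0 : 0 < q by lra.
pose D := 32 * p ^+ 2 - 52 * p + 21.
have D0 : 0 < D.
  have -> : D = (4 * q - 3) * (2 * q - 1) by rewrite /D /q; ring.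
  by apply: mulr_gt0; lra.
pose sD := Num.sqrt D.
have sD0 : 0 < sD by rewrite sqrtr_gt0.
have sD2 : sD ^+ 2 = D by rewrite sqr_sqrtr// ltW.
(* The nonzero equilibrium: s' = 0 gives q (2 - tau) = 1, and t' = 0 then gives sg^2 = tau (3 tau -
   2) / q^2 = (2 q - 1)(4 q - 3) / q^4 = D / q^4. *)
pose tau := 2 - q^-1; pose sg := sD / q ^+ 2.
have sg0 : 0 < sg by rewrite divr_gt0// exprn_gt0.
have h1 : q * (2 - tau) = 1 by rewrite /tau opprB addrCA subrr addr0 mulfV// gt_eqF.
have h2 : tau - 3 / 2 * tau ^+ 2 + q ^+ 2 / 2 * sg ^+ 2 = 0.
  rewrite /sg expr_div_n sD2.
  have -> : D = (4 * q - 3) * (2 * q - 1) by rewrite /D /q; ring.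
  by rewrite /tau; field; rewrite gt_eqF.
have gpE : gamma_p p = point tau sg.
  rewrite /gamma_p /point -/D -/sD /tau /sg.
  have -> : 8 * p ^+ 2 - 10 * p + 3 = q * (2 * q - 1) by rewrite /q; ring.
  by rewrite -/q; congr vec2; field; rewrite gt_eqF.
have gbE : gammabar_p p = point tau (- sg).
  rewrite /gammabar_p /point -/D -/sD /tau /sg.
  have -> : 8 * p ^+ 2 - 10 * p + 3 = q * (2 * q - 1) by rewrite /q; ring.
  by rewrite -/q; congr vec2; field; rewrite gt_eqF.
have dgp : gamma_p p 0 0 - gamma_p p 1 0 = sg.
  by rewrite gpE /point !mxE /=; field.
have dgb : gammabar_p p 0 0 - gammabar_p p 1 0 = - sg.
  by rewrite gbE /point !mxE /=; field.
(* [gammabar_p p] also serves as the default on paths without a limit. The two-value alternative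
   thus holds everywhere, and only the convergence is almost sure. *)
pose Gp w := if pselect ((fun n => G n w) @ \oo --> gamma_p p)
  then gamma_p p else gammabar_p p.
have Gp_or w : Gp w = gamma_p p \/ Gp w = gammabar_p p.
  by rewrite /Gp; case: pselect => h; [left|right].
have cvgG : {ae P, forall w, (fun n => G n w) @ \oo --> Gp w}.
  (* The lower bound is equivalent to q > 3/4, the upper one to q <= 1. *)
  have tau01 : 2 / 3 < tau <= 1.
    have : q^-1 < 4 / 3 by rewrite -[4 / 3]invf_div ltf_pV2// posrE.
    have : 1 <= q^-1 by rewrite invf_ge1.
    by rewrite /tau => *; apply/andP; split; lra.
  have := ae_state_cvg p01 model
    (pair_summable p01 (ltW q34) h1 h2 (sqr_ge0 sg) tau01).
  apply: filterS2 (ae_path_ok p01 model) => w hok [ht hs].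
  rewrite /Gp; case: pselect => // nG.
  have step m : `|posn (walk_at x1 x2 u1 u2 a1 a2 m.+3 w) / m.+3%:R -
      posn (walk_at x1 x2 u1 u2 a1 a2 m.+2 w) / m.+2%:R| <= 2 / m.+2%:R :> R.
    have := @path_increments R (fun m => walk_at x1 x2 u1 u2 a1 a2 m.+2 w) hok _ m.
    by case=> // k; exact: walk_rcons.
  have sg20 : 0 < sg ^+ 2 by rewrite exprn_gt0.
  have := sqr_cvg_sign sg20 hs step; rewrite sqrtr_sqr (gtr0_norm sg0).
  case=> hsg; first by case: nG; rewrite gpE; exact: Gamma_cvg.
  by rewrite gbE; exact: Gamma_cvg.
exists Gp; split => //; split => [|_]; first by lra.
split; first by apply: aeW.
split.
  (* If [gamma_p p] had probability 0, the limit would almost surely be the other point and S_n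
     would almost surely be eventually negative. *)
  move=> neg; apply: (not_ae_eventually p01 model (e := false)).
  have : {ae P, forall w, ~ (Gp w = gamma_p p)}.
    by have [N [mN N0 hN]] := neg; exists N; split => // w /= /contrapT; exact: hN.
  apply: filterS2 cvgG => w hG nw; have [//|Gw] := Gp_or w.
  rewrite Gw in hG; apply: (eventually_sign (e := false) hG) => /=.
  by rewrite dgb oppr_lt0.
split.
  move=> neg; apply: (not_ae_eventually p01 model (e := true)).
  have : {ae P, forall w, ~ (Gp w = gammabar_p p)}.
    by have [N [mN N0 hN]] := neg; exists N; split => // w /= /contrapT; exact: hN.
  apply: filterS2 cvgG => w hG nw; have [Gw|//] := Gp_or w.
  rewrite Gw in hG; apply: (eventually_sign (e := true) hG) => /=.
  by rewrite dgp.
move=> g gE.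
have covg : {ae P, forall w, (fun n => G n w) @ \oo --> g ->
    (fun n => C n w) @ \oo --> sigma_mx g}.
  case: gE => ->; [rewrite gpE|rewrite gbE]; apply: ae_cov_point => //.
  - by rewrite -/q h1 subrr mulr0.
  - by rewrite -/q h1 subrr mulr0.
  - by rewrite sqrrN.
by apply: filterS2 cvgG covg => w hG hC Gw; apply: hC; rewrite -Gw.
Qed.
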